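(* Let $1<\alpha\le2$, $|\theta|\le\min\{\alpha,2-\alpha\}$, and let $f\in C^\infty(\mathbb{R})$ satisfy $f(0)=0=f(1)$, $f'(0)<0$, $f'(1)<0$. Suppose $(U,c)$ is a traveling wave solution of $\frac{\partial u}{\partial t}=D^\alpha_\theta u+f(u)$ satisfying $$U\in C^1(\mathbb{R}),\quad \lim_{\xi\to-\infty}U(\xi)=0,\quad \lim_{\xi\to+\infty}U(\xi)=1,\quad U'(\xi)>0\ \text{on }\mathbb{R},\quad \lim_{|\xi|\to\infty}U'(\xi)=0.$$ Then for any traveling wave solution $(\tilde U,\tilde c)$ of the same equation with $\tilde U\in C(\mathbb{R})$, $\lim_{\xi\to-\infty}\tilde U(\xi)=0$, $\lim_{\xi\to+\infty}\tilde U(\xi)=1$ and $0\le\tilde U\le1$ on $\mathbb{R}$, we have $\tilde c=c$ and $\tilde U(\cdot)=U(\cdot+\xi_0)$ for some $\xi_0\in\mathbb{R}$.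
   Context: $C^k_b(\mathbb{R})$: functions with bounded continuous derivatives up to order $k$. For $1<\alpha<2$ set $c_1=\frac{\Gamma(1+\alpha)\sin((\alpha+\theta)\pi/2)}{\pi}$, $c_2=\frac{\Gamma(1+\alpha)\sin((\alpha-\theta)\pi/2)}{\pi}$ and, for $g\in C_b^2(\mathbb{R})$, $$D^\alpha_\theta g(x)=c_1\int_0^\infty\frac{g(x+\xi)-g(x)-g'(x)\xi}{\xi^{1+\alpha}}\,d\xi+c_2\int_0^\infty\frac{g(x-\xi)-g(x)+g'(x)\xi}{\xi^{1+\alpha}}\,d\xi;$$ for $\alpha=2$ (so $\theta=0$) $D^2_0g=g''$. A traveling wave solution $(U,c)$ of $\partial_tu=D^\alpha_\theta u+f(u)$ is a solution of the form $u(x,t)=U(x-ct)$ with $c\in\mathbb{R}$; its profile satisfies the traveling wave equation $-cU'=D^\alpha_\theta U+f(U)$ on $\mathbb{R}$, where profiles are understood to lie in $C^2_b(\mathbb{R})$ so that the operator is well defined. *)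

(* Defs.v *)
From HB Require Import structures.
From mathcomp Require Import all_boot all_order all_algebra.
From mathcomp Require Import all_classical all_reals all_analysis.
Set Implicit Arguments.
Unset Strict Implicit.
Unset Printing Implicit Defensive.
Import Order.TTheory GRing.Theory Num.Theory.
Import numFieldNormedType.Exports.
Local Open Scope ring_scope.
Local Open Scope classical_set_scope.

(* [derive1n] is total, so differentiability is required at every order at
   which a further derivative is taken. *)
Definition smooth (R : realType) (f : R -> R) : Prop :=
  forall (n : nat) (x : R), derivable f^`(n) x 1.

Definition Ck (R : realType) (k : nat) (g : R -> R) : Prop :=
  (forall i : nat, (i < k)%N -> forall x : R, derivable g^`(i) x 1) /\
  (forall i : nat, (i <= k)%N -> continuous g^`(i)).

Definition Ckb (R : realType) (k : nat) (g : R -> R) : Prop :=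
  Ck k g /\
  forall i : nat, (i <= k)%N -> exists M : R, forall x : R, `|g^`(i) x| <= M.

(* Euler's integral; it converges for s > 0. *)
Definition Gamma (R : realType) (s : R) : R :=
  \int[lebesgue_measure]_(t in `]0, +oo[) (t `^ (s - 1) * expR (- t)).

Section RieszFeller.
Context {R : realType}.
Implicit Types (alpha theta x t c : R) (g f U : R -> R) (u : R -> R -> R).

Definition coef1 alpha theta : R :=
  Gamma (1 + alpha) * sin ((alpha + theta) * pi / 2) / pi.

Definition coef2 alpha theta : R :=
  Gamma (1 + alpha) * sin ((alpha - theta) * pi / 2) / pi.

(* For g in C^2_b and 1 < alpha < 2 both integrals converge absolutely: the
   integrands are O(xi^(1 - alpha)) at 0 and O(xi^(- alpha)) at infinity.  For
   alpha = 2 the constraint |theta| <= min(alpha, 2 - alpha) gives theta = 0. *)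
Definition RieszFeller alpha theta g x : R :=
  if alpha == 2 then g^`(2) x else
    coef1 alpha theta *
      (\int[lebesgue_measure]_(xi in `]0, +oo[)
         ((g (x + xi) - g x - g^`()%classic x * xi) / xi `^ (1 + alpha))) +
    coef2 alpha theta *
      (\int[lebesgue_measure]_(xi in `]0, +oo[)
         ((g (x - xi) - g x + g^`()%classic x * xi) / xi `^ (1 + alpha))).

(* Entire-in-time classical solutions u(x, t) of
   d_t u = D^alpha_theta u + f(u), with spatial slices in C^2_b. *)
Definition is_solution alpha theta f u : Prop :=
  forall t, Ckb 2 (fun x => u x t) /\
    forall x, derivable (u x) t 1 /\
      (u x)^`() t = RieszFeller alpha theta (fun y => u y t) x + f (u x t).

Definition traveling_wave alpha theta f U c : Prop :=
  is_solution alpha theta f (fun x t => U (x - c * t)).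

Lemma derive1_shift g a x : (fun y => g (y + a))^`() x = g^`() (x + a).
Proof.
rewrite /derive1; under eq_fun do rewrite -addrA.
by [].
Qed.

Lemma derive1n_shift g a n : (fun y => g (y + a))^`(n) = (fun y => g^`(n) (y + a)).
Proof.
elim: n => [//|n IH].
by apply/funext => x; rewrite !derive1nS IH derive1_shift.
Qed.

Lemma RieszFeller_shift alpha theta g a x :
  RieszFeller alpha theta (fun y => g (y + a)) x =
  RieszFeller alpha theta g (x + a).
Proof.
rewrite /RieszFeller derive1n_shift derive1_shift.
case: ifP => // _; congr (_ * _ + _ * _);
  by apply: eq_Rintegral => xi _; rewrite (addrAC x).
Qed.

Lemma derivable_shift g a x :
  derivable g (x + a) 1 -> derivable (fun y => g (y + a)) x 1.
Proof.
by rewrite /derivable => dg; under eq_fun do rewrite /= -addrA.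
Qed.

Lemma Ckb_shift k g a : Ckb k g -> Ckb k (fun y => g (y + a)).
Proof.
move=> [[dg cg] bg]; split; [split|] => i ik.
- by move=> x; rewrite derive1n_shift; exact/derivable_shift/dg.
- move=> x; rewrite derive1n_shift.
  apply: (@continuous_comp _ _ _ (fun y => y + a) g^`(i)); last exact: cg.
  by apply: cvgD; [exact: cvg_id|exact: cvg_cst].
- have [M gM] := bg i ik; exists M => x; rewrite derive1n_shift; exact: gM.
Qed.

(* The profile equation of a traveling wave. *)
Lemma traveling_waveP alpha theta f U c :
  traveling_wave alpha theta f U c <->
  Ckb 2 U /\
  forall x, - c * U^`()%classic x = RieszFeller alpha theta U x + f (U x).
Proof.
have dt : Ckb 2 U -> forall x t,
    is_derive t 1 (fun s => U (x - c * s)) (- c * U^`()%classic (x - c * t)).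
  move=> [[dU _] _] x t.
  have dU1 : is_derive (x - c * t) 1 U (U^`()%classic (x - c * t)).
    by rewrite derive1E; apply: derivableP; exact: (dU 0%N).
  have dl : is_derive t 1 (fun s => x - c * s) (- c).
    apply: is_derive_eq.
    by rewrite /GRing.scale/= add0r mul1r mulr1.
  rewrite mulrC; exact: (@is_derive1_comp _ U (fun s => x - c * s) t _ _ dU1 dl).
split=> [sU|[CU eU]].
  have CU : Ckb 2 U.
    have [+ _] := sU 0; congr (Ckb 2 _).
    by apply/funext => x; rewrite mulr0 subr0.
  split=> // x.
  have [_ /(_ x)[_]] := sU 0.
  rewrite derive1E (@derive_val _ _ _ _ _ _ _ (dt CU x 0)).
  by rewrite (RieszFeller_shift _ _ U) mulr0 oppr0 addr0.
move=> t; split; first exact: Ckb_shift.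
move=> x; have dxt := dt CU x t; split; first exact: ex_derive.
by rewrite derive1E (@derive_val _ _ _ _ _ _ _ dxt) (RieszFeller_shift _ _ U) eU.
Qed.

End RieszFeller.

(* Main.v *)
Require Import Defs.
From HB Require Import structures.
From mathcomp Require Import all_boot all_order all_algebra.
From mathcomp Require Import all_classical all_reals all_analysis.
From mathcomp Require Import measurable_realfun ring lra.
Import Order.TTheory GRing.Theory Num.Theory.
Import numFieldNormedType.Exports.
Local Open Scope ring_scope.
Local Open Scope classical_set_scope.

(** The proof is a sliding argument that uses the stationary profile equations
only.  Write D for the Riesz-Feller operator.

At a global minimum the first derivative vanishes, and the two jump integrals
(or the second derivative, when alpha = 2) are nonnegative; since the
coefficients of D are nonnegative, D g >= 0 at a global minimum of g
([RieszFeller_min_ge0]).  Apply this to U(. + tau) - V, where U is the profile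
of speed c and V the one of speed c'.  At a global minimum the two first
derivatives agree, and subtracting the profile equations gives
  f (U) <= f (V) + (c' - c) U'.
Suppose c' <= c.  If the minimum is negative, then U < V there, while
f (U) <= f (V); this is impossible when both values lie near 0 or both near 1,
because f is strictly decreasing there.  For large tau a point of the line with
U(. + tau) < V can only be of that kind, hence V <= U(. + tau).  Let t be the
least shift with this property.  If U(. + t) - V were positive everywhere, it
would be bounded below by a positive constant on a large segment, and outside of
the segment the values are again near 0 or near 1, so a smaller shift would do.
Hence U(. + t) - V vanishes somewhere, and the inequality above, with U = V and
U' > 0, forces c' = c.  The difference then satisfies |D w| <= C (|w'| + w), w >= 0, and has a
zero, and it is identically zero by the strong maximum principle [strong_max].

The case c <= c' reduces to this one by the reflection x -> - x, u -> 1 - u,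
which exchanges the two coefficients and changes the sign of the speed
([traveling_wave_reflect]).

The strong maximum principle needs some care, because for extremal theta one of
the two coefficients vanishes and D then looks in one direction only.  In the
direction in which D looks, a zero w(x0) = 0 propagates since the integral of a
nonnegative function vanishes ([RieszFeller_min_right]).  In the blind direction,
and in both directions when alpha = 2, w is compared with the parabola
eps (x0 - x)^2 on a short segment ending at x0 ([RieszFeller_barrier]): at an
interior minimum of the difference, at distance s from x0, D w is at least of
order eps s^(2 - alpha), while the differential inequality bounds it by a
multiple of eps s; these are incompatible for small s because alpha > 1.  All of
this requires Gamma (1 + alpha) > 0 and the absolute convergence of the
integrals; both come from dominating functions that have bounded primitives
([integrable_bounded_primitive]). *)

Set Implicit Arguments.
Unset Strict Implicit.

(** * Continuity from derivatives *)

Section derivative_continuity.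
Context {R : realType}.
Implicit Types (g : R -> R) (x y c : R).

Lemma is_derive_continuous g x (d : R) :
  is_derive x 1 g d -> {for x, continuous g}.
Proof.
by move=> dg; apply: differentiable_continuous; exact/derivable1_diffP/ex_derive.
Qed.

Lemma is_derive_continuousT g (g1 : R -> R) :
  (forall x : R, is_derive x 1 g (g1 x)) -> continuous g.
Proof. by move=> dg x; exact: is_derive_continuous (dg x). Qed.

Lemma powR_continuous c x : 0 < x -> {for x, continuous (fun y => y `^ c)}.
Proof. by move=> x0; exact: is_derive_continuous (is_derive1_powR c x0). Qed.

End derivative_continuity.

(** * Integrability on the positive half-line *)

Section bounded_primitive.
Context {R : realType}.
Local Notation mu := (@lebesgue_measure R).
Local Notation Rpos := (`](0%R : R), +oo[%classic).

Lemma gt0_exhaustion :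
  Rpos = \bigcup_n `[n.+1%:R^-1, n.+1%:R]%classic :> set R.
Proof.
apply/seteqP; split => x /=.
  rewrite in_itv/= andbT => x0.
  have [n nx] : exists n : nat, x^-1 + x <= n.+1%:R.
    exists (Num.truncn (x^-1 + x)).
    exact/ltW/truncnS_gt.
  exists n => //=; rewrite in_itv/=; apply/andP; split.
    rewrite -[x]invrK lef_pV2 ?posrE ?invr_gt0 ?ltr0Sn//.
    by apply: le_trans nx; rewrite lerDl ltW.
  by apply: le_trans nx; rewrite lerDr invr_ge0 ltW.
move=> [n _] /=; rewrite !in_itv/= andbT => /andP[+ _].
by apply: lt_le_trans; rewrite invr_gt0 ltr0Sn.
Qed.

(** The integral of f over [1/n, n] is a difference of two values of F, hence at
most 2 M, and these segments exhaust the half-line.  Singularities of f at 0 and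
the behaviour at infinity are thus treated together. *)
Lemma integrable_bounded_primitive (f F : R -> R) (M : R) :
  (forall x : R, 0 < x -> 0 <= f x) ->
  (forall x : R, 0 < x -> {for x, continuous f}) ->
  (forall x : R, 0 < x -> is_derive x 1 F (f x)) ->
  (forall x : R, 0 < x -> `|F x| <= M) ->
  mu.-integrable Rpos (EFin \o f).
Proof.
move=> f0 cf dF FM.
have mf : measurable_fun Rpos f.
  apply: open_continuous_measurable_fun => //.
  by move=> x; rewrite inE/= in_itv/= andbT => /cf.
apply/integrableP; split; first exact/measurable_EFinP.
have -> : (\int[mu]_(x in Rpos) `|(EFin \o f) x| =
    \int[mu]_(x in Rpos) (f x)%:E)%E.
  apply: eq_integral => x; rewrite inE/= in_itv/= andbT => x0.
  by rewrite ger0_norm// f0.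
pose A (n : nat) : set R := `[n.+1%:R^-1, n.+1%:R]%classic.
have AE n x : A n x -> 0 < x.
  by rewrite /A/= in_itv/= => /andP[+ _]; apply: lt_le_trans; rewrite invr_gt0.
have cvgA : (\int[mu]_(x in A n) (f x)%:E @[n --> \oo] -->
    \int[mu]_(x in Rpos) (f x)%:E)%E.
  rewrite gt0_exhaustion; apply: ge0_nondecreasing_set_cvg_integral => //.
  - move=> m n mn; apply/subsetPset => x; rewrite /A/= !in_itv/= => /andP[mx xm].
    rewrite (le_trans _ mx) ?(le_trans xm) ?ler_nat//.
    by rewrite lef_pV2 ?posrE ?ler_nat.
  - by move=> n; exact: measurable_itv.
  - move=> n; apply/measurable_EFinP; apply: measurable_funS mf => // x /AE x0.
    by rewrite /= in_itv/= andbT.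
  - by move=> n x /AE x0; rewrite lee_fin f0.
apply: (@le_lt_trans _ _ (2 * M)%:E); last exact: ltry.
rewrite -(cvg_lim _ cvgA)//; apply: lime_le; first by apply/cvg_ex; eexists; exact: cvgA.
apply: nearW => -[|n].
  rewrite /A invr1 set_itv1 integral_set1 lee_fin mulr_ge0//.
  by apply: le_trans (FM 1 ltr01).
have n1 : n.+2%:R^-1 < n.+2%:R :> R.
  by rewrite (@lt_trans _ _ 1)// ?ltr1n// invf_lt1// ltr1n.
have pos x : n.+2%:R^-1 <= x -> 0 < x by apply: lt_le_trans; rewrite invr_gt0.
have cF x : 0 < x -> {for x, continuous F}.
  by move=> /dF; exact: is_derive_continuous.
rewrite /A (@continuous_FTC2 _ f F)//.
- rewrite -EFinB lee_fin (le_trans (ler_norm _))// (le_trans (ler_normB _ _))//.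
  by rewrite mulrDl mul1r lerD// FM// pos// ltW.
- apply: continuous_in_subspaceT => x; rewrite inE/= in_itv/= => /andP[/pos x0 _].
  exact: cf.
- split.
  + move=> x; rewrite in_itv/= => /andP[/ltW /pos /dF dFx _]; exact: ex_derive.
  + by apply: cvg_at_right_filter; apply: cF; exact: pos.
  + by apply: cvg_at_left_filter; apply: cF; apply: pos; exact: ltW.
- move=> x; rewrite in_itv/= => /andP[/ltW /pos /dF dFx _].
  by rewrite derive1E derive_val.
Qed.

End bounded_primitive.

(** * Bounded functions of class C^2 *)

Section Ckb2.
Context {R : realType}.
Implicit Types (g h : R -> R).

(** Membership in the class is defined through iterated total derivatives; this
lemma and the next one translate it to and from derivatives given explicitly. *)
Lemma Ckb2_intro g (g1 g2 : R -> R) (M : R) :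
  (forall x : R, is_derive x 1 g (g1 x)) ->
  (forall x : R, is_derive x 1 g1 (g2 x)) -> continuous g2 ->
  (forall x : R, [/\ `|g x| <= M, `|g1 x| <= M & `|g2 x| <= M]) ->
  [/\ Ckb 2 g, g^`() = g1 & g^`(2) = g2].
Proof.
move=> dg dg1 cg2 gM.
have e1 : g^`() = g1 by apply/funext => x; rewrite derive1E derive_val.
have e2 : g^`(2) = g2.
  by apply/funext => x; rewrite derive1nS derive1n1 e1 derive1E derive_val.
split => //; split; [split|].
- by move=> [|[|//]] _ x; rewrite ?derive1n1 ?e1; exact: ex_derive.
- move=> [|[|[|//]]] _; rewrite ?derive1n1 ?e1 ?e2//;
    exact: is_derive_continuousT.
- move=> [|[|[|//]]] _; exists M => x; rewrite ?derive1n1 ?e1 ?e2;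
  by have [] := gM x.
Qed.

Lemma Ckb2_elim g : Ckb 2 g ->
  [/\ forall x : R, is_derive x 1 g (g^`() x),
      forall x : R, is_derive x 1 g^`() (g^`(2) x), continuous g^`(2) &
      exists M : R, forall x : R,
        [/\ `|g x| <= M, `|g^`()%classic x| <= M & `|g^`(2)%classic x| <= M]].
Proof.
move=> [[dg cg] bg]; split.
- by move=> x; rewrite derive1E; apply: derivableP; exact: (dg 0%N).
- move=> x; rewrite derive1nS derive1n1 derive1E; apply: derivableP.
  by have := dg 1%N isT x; rewrite derive1n1.
- exact: cg.
- have [M0 h0] := bg 0%N isT; have [M1 h1] := bg 1%N isT.
  have [M2 h2] := bg 2%N isT.
  exists (Num.max M0 (Num.max M1 M2)) => x; split; rewrite !le_max.
  + by rewrite h0.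
  + by have := h1 x; rewrite derive1n1 => ->; rewrite orbT.
  + by rewrite h2 !orbT.
Qed.

Lemma is_derive_opp_arg g (g1 x : R) :
  is_derive (- x) 1 g g1 -> is_derive x 1 (fun y => g (- y)) (- g1).
Proof.
move=> dg; have dN : is_derive x 1 (fun y : R => - y) (- 1).
  exact: is_deriveN.
have := @is_derive1_comp _ g (fun y : R => - y) x _ _ dg dN.
by rewrite mulrN1.
Qed.

Lemma Ckb2_sub g h : Ckb 2 g -> Ckb 2 h ->
  [/\ Ckb 2 (fun x => g x - h x),
      (fun x => g x - h x)^`() =
        (fun x => g^`()%classic x - h^`()%classic x) &
      (fun x => g x - h x)^`(2) =
        (fun x => g^`(2)%classic x - h^`(2)%classic x)].
Proof.
move=> /Ckb2_elim[dg dg1 cg2 [M gM]] /Ckb2_elim[dh dh1 ch2 [N hN]].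
apply: (@Ckb2_intro _ _ _ (M + N)).
- by move=> x; apply: cvgB; [exact: cg2|exact: ch2].
- move=> x; have [? ? ?] := gM x; have [? ? ?] := hN x.
  by split; rewrite (le_trans (ler_normB _ _))// lerD.
Qed.

Lemma Ckb2_opp_arg g : Ckb 2 g ->
  [/\ Ckb 2 (fun x => g (- x)),
      (fun x => g (- x))^`() = (fun x => - g^`()%classic (- x)) &
      (fun x => g (- x))^`(2) = (fun x => g^`(2) (- x))].
Proof.
move=> /Ckb2_elim[dg dg1 cg2 [M gM]].
apply: (@Ckb2_intro _ _ _ M).
- by move=> x; exact: is_derive_opp_arg.
- move=> x; rewrite -[g^`(2) _]opprK; apply: is_deriveN.
  exact: is_derive_opp_arg.
- move=> x; apply: (@continuous_comp _ _ _ (fun y : R => - y) g^`(2)).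
    by apply: cvgN; exact: cvg_id.
  exact: cg2.
- by move=> x; have [? ? ?] := gM (- x); rewrite normrN.
Qed.

Lemma Ckb2_cst (a : R) :
  [/\ Ckb 2 (cst a), (cst a)^`() = cst 0 & (cst a)^`(2) = cst (0 : R)].
Proof.
apply: (@Ckb2_intro _ _ _ `|a|).
- by move=> x; exact: cvg_cst.
- by move=> x; rewrite /= normr0.
Qed.

(** The constant 1/2 of Taylor's formula is lost by applying the mean value theorem
twice, to g and then to its derivative. *)
Lemma taylor2_bound g (x s m : R) :
  Ckb 2 g -> 0 <= s -> (forall y, x <= y <= x + s -> `|g^`(2)%classic y| <= m) ->
  `|g (x + s) - g x - g^`()%classic x * s| <= m * s ^+ 2.
Proof.
move=> /Ckb2_elim[dg dg1 _ _] s0 gm.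
have xs : x <= x + s by rewrite lerDl.
have [y + ->] := @MVT_segment _ g g^`() x (x + s) xs
  (fun z _ => dg z) (continuous_subspaceT (is_derive_continuousT dg)).
rewrite in_itv/= => /andP[xy ys].
have [z + e] := @MVT_segment _ g^`() g^`(2) x y xy
  (fun z _ => dg1 z) (continuous_subspaceT (is_derive_continuousT dg1)).
rewrite in_itv/= => /andP[xz zy].
rewrite addrAC subrr add0r -mulrBl e -mulrA normrM.
apply: ler_pM => //; first by rewrite gm// xz (le_trans zy).
rewrite expr2 normrM (ger0_norm s0) ler_wpM2r// ger0_norm ?subr_ge0//.
by rewrite lerBlDl.
Qed.

End Ckb2.

(** * Convergence of the jump integrals *)

Section jump.
Context {R : realType}.
Local Notation mu := (@lebesgue_measure R).
Local Notation Rpos := (`](0%R : R), +oo[%classic).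
Implicit Types (g : R -> R).

Definition increment g (x xi : R) : R := g (x + xi) - g x - g^`()%classic x * xi.

Definition jump (alpha : R) g (x xi : R) : R :=
  increment g x xi / xi `^ (1 + alpha).

Definition jump_integral (alpha : R) g (x : R) : R :=
  \int[mu]_(xi in Rpos) jump alpha g x xi.

(** This kernel behaves like x^(b - 1) at 0 and like x^(b - 2) at infinity, and it
is the derivative of - (1 + x^b)^(1 - 1/b), which takes values in [-1, 0].  With
b = 2 - alpha these are the two rates of the integrand of a jump integral. *)
Lemma integrable_kernel (b : R) : 0 < b < 1 ->
  mu.-integrable Rpos
    (EFin \o (fun x => (1 - b) * (x `^ (b - 1) * (1 + x `^ b) `^ (- b^-1)))).
Proof.
move=> /andP[b0 b1].
have s0 (x : R) : 0 < 1 + x `^ b by rewrite ltr_wpDr// powR_ge0.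
have dF (c x : R) : 0 < x -> is_derive x 1 (fun y => (1 + y `^ b) `^ c)
    (c * (1 + x `^ b) `^ (c - 1) * (b * x `^ (b - 1))).
  move=> x0; have dx := is_derive1_powR b x0.
  have d1 : is_derive x 1 (fun y : R => 1 + y `^ b) (b * x `^ (b - 1)).
    by rewrite -[b * _]add0r; exact: is_deriveD.
  exact: (@is_derive1_comp _ (fun y => y `^ c) (fun y => 1 + y `^ b) x _ _
    (is_derive1_powR c (s0 x)) d1).
apply: (@integrable_bounded_primitive _ _
  (fun x => - (1 + x `^ b) `^ (1 - b^-1)) 1).
- by move=> x x0; rewrite mulr_ge0 ?subr_ge0 ?(ltW b1)// mulr_ge0// powR_ge0.
- move=> x x0; apply: cvgM; first exact: cvg_cst.
  apply: cvgM; first exact: powR_continuous.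
  exact: is_derive_continuous (dF (- b^-1) x x0).
- move=> x x0; have := @is_deriveN _ _ _ _ _ _ _ (dF (1 - b^-1) x x0).
  congr is_derive.
  rewrite (_ : 1 - b^-1 - 1 = - b^-1); last by ring.
  rewrite (_ : (1 - b) = - ((1 - b^-1) * b)); first by ring.
  by rewrite mulrBl mulVf ?gt_eqF//; ring.
- move=> x x0; rewrite normrN ger0_norm ?powR_ge0//.
  have -> : 1 - b^-1 = - (b^-1 - 1) by ring.
  rewrite powRN invf_le1 ?powR_gt0//.
  rewrite -[leLHS](_ : 1 `^ (b^-1 - 1) = 1); last by rewrite powR1.
  rewrite ge0_ler_powR ?nnegrE ?lerDl ?powR_ge0 ?(ltW (s0 x))//.
  by rewrite subr_ge0 invf_ge1// ltW.
Qed.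

(** The quadratic bound serves near 0 and the linear one near infinity. *)
Lemma increment_bound g : Ckb 2 g ->
  exists2 M, 0 <= M & forall x xi, 0 < xi ->
    `|increment g x xi| <= M * xi ^+ 2 /\ `|increment g x xi| <= M * (1 + xi).
Proof.
move=> Cg; have [_ _ _ [M gM]] := Ckb2_elim Cg.
have M0 : 0 <= M by have [+ _ _] := gM 0; apply: le_trans.
exists (2 * M) => [|x xi xi0]; first by rewrite mulr_ge0.
split.
  apply: le_trans (taylor2_bound Cg (ltW xi0) _) _.
    by move=> y _; have [_ _] := gM y; apply.
  by rewrite ler_wpM2r ?exprn_ge0 ?(ltW xi0)// ler_peMl// ler1n.
rewrite /increment (le_trans (ler_normB _ _))//.
have [gx g1x _] := gM x; have [gxi _ _] := gM (x + xi).
have h1 : `|g (x + xi) - g x| <= 2 * M.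
  by rewrite (le_trans (ler_normB _ _))// mulr_natl mulr2n lerD.
have h2 : `|g^`()%classic x * xi| <= M * xi.
  by rewrite normrM (gtr0_norm xi0) ler_wpM2r// ltW.
rewrite mulrDr mulr1 lerD// (le_trans h2)// ler_wpM2r ?(ltW xi0)//.
by rewrite ler_peMl// ler1n.
Qed.

Lemma integrable_jump alpha g x : 1 < alpha < 2 -> Ckb 2 g ->
  mu.-integrable Rpos (EFin \o jump alpha g x).
Proof.
move=> /andP[a1 a2] Cg; have [M M0 gM] := increment_bound Cg.
have [dg _ _ _] := Ckb2_elim Cg.
set b := 2 - alpha; have b0 : 0 < b by rewrite /b; lra.
have b1 : b < 1 by rewrite /b; lra.
have cg : continuous g by exact: is_derive_continuousT dg.
(* The worst constant of the two regimes y <= 1 and 1 <= y. *)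
pose C := 2 * M * 2 `^ b^-1 / (1 - b).
have C0 : 0 <= C by rewrite divr_ge0 ?mulr_ge0 ?powR_ge0// subr_ge0 ltW.
have mj : measurable_fun Rpos (jump alpha g x).
  apply: open_continuous_measurable_fun => //.
  move=> y; rewrite inE/= in_itv/= andbT => y0.
  apply: cvgM; last first.
    by apply: cvgV; [rewrite gt_eqF// powR_gt0|exact: powR_continuous].
  apply: cvgB; last by apply: cvgM; [exact: cvg_cst|exact: cvg_id].
  apply: cvgB; last exact: cvg_cst.
  apply: (@continuous_comp _ _ _ (fun z => x + z) g); last exact: cg.
  by apply: cvgD; [exact: cvg_cst|exact: cvg_id].
have b01 : 0 < b < 1 by rewrite b0.
apply: (@le_integrable _ _ _ mu _ _ _ (fun y => C%:E *
  ((1 - b) * (y `^ (b - 1) * (1 + y `^ b) `^ (- b^-1)))%:E)%E) => //.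
- exact/measurable_EFinP.
- move=> y; rewrite /= in_itv/= andbT => y0.
  have s0 : 0 < 1 + y `^ b by rewrite ltr_wpDr// powR_ge0.
  rewrite lee_fin [leRHS]ger0_norm; last first.
    rewrite mulr_ge0// mulr_ge0 ?subr_ge0 ?(ltW b1)//.
    by rewrite mulr_ge0 ?powR_ge0.
  rewrite /jump normrM [`|_^-1|]ger0_norm ?invr_ge0 ?powR_ge0//.
  have -> : y `^ (b - 1) = y ^+ 2 / y `^ (1 + alpha).
    rewrite -powR_mulrn ?(ltW y0)// -powRB; last by rewrite (gt_eqF y0) implybT.
    by congr (_ `^ _); rewrite /b; ring.
  have -> : C * ((1 - b) * (y ^+ 2 / y `^ (1 + alpha) * (1 + y `^ b) `^ (- b^-1)))
    = (2 * M * 2 `^ b^-1 * y ^+ 2 / (1 + y `^ b) `^ b^-1) / y `^ (1 + alpha).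
    rewrite powRN /C; field.
    by rewrite !gt_eqF ?powR_gt0// subr_gt0.
  rewrite ler_wpM2r ?invr_ge0 ?powR_ge0// ler_pdivlMr ?powR_gt0//.
  have [iy iy'] := gM x y y0.
  have [y1|/ltW y1] := leP y 1.
    have h : (1 + y `^ b) `^ b^-1 <= 2 `^ b^-1.
      rewrite ge0_ler_powR ?nnegrE ?invr_ge0 ?(ltW b0) ?(ltW s0)//.
      rewrite (_ : 2 = 1 + 1)// lerD2l.
      rewrite -[leRHS](_ : 1 `^ b = 1); last by rewrite powR1.
      by rewrite ge0_ler_powR ?nnegrE// ltW.
    apply: le_trans (ler_pM _ _ iy h) _ => //; first exact: powR_ge0.
    have -> : 2 * M * 2 `^ b^-1 * y ^+ 2 = 2 * (M * y ^+ 2 * 2 `^ b^-1) by ring.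
    by rewrite ler_peMl ?ler1n// !mulr_ge0 ?powR_ge0 ?exprn_ge0// ltW.
  have h : (1 + y `^ b) `^ b^-1 <= 2 `^ b^-1 * y.
    have {2}-> : y = (y `^ b) `^ b^-1.
      by rewrite -powRrM divff ?gt_eqF// powRr1// ltW.
    rewrite -powRM ?powR_ge0// ge0_ler_powR ?nnegrE ?invr_ge0 ?(ltW b0) ?(ltW s0)//.
      by rewrite mulr_ge0 ?powR_ge0.
    rewrite mulr_natl mulr2n lerD2r.
    rewrite -[leLHS](_ : 1 `^ b = 1); last by rewrite powR1.
    by rewrite ge0_ler_powR ?nnegrE ?(ltW b0) ?(ltW y0).
  apply: le_trans (ler_pM _ _ iy' h) _ => //; first exact: powR_ge0.
  have -> : 2 * M * 2 `^ b^-1 * y ^+ 2 = (M * (y + y)) * (2 `^ b^-1 * y) by ring.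
  rewrite ler_wpM2r ?mulr_ge0 ?powR_ge0 ?(ltW y0)// ler_wpM2l// lerD2r//.
- apply: integrableZl => //; exact: integrable_kernel.
Qed.

End jump.

(** * Algebra of the operator and signs of its coefficients *)

Section riesz_feller.
Context {R : realType}.
Local Notation mu := (@lebesgue_measure R).
Local Notation Rpos := (`](0%R : R), +oo[%classic).
Implicit Types (g h : R -> R) (alpha theta : R).

(** Integrability matters: the real-valued integral is 0 when the extended one is
infinite. *)
Lemma Rintegral_ge_itv (f : R -> R) (p q m : R) : 0 < p -> p <= q ->
  mu.-integrable Rpos (EFin \o f) -> (forall x, 0 < x -> 0 <= f x) ->
  (forall x, p <= x <= q -> m <= f x) ->
  m * (q - p) <= \int[mu]_(x in Rpos) f x.
Proof.
move=> p0 pq intf f0 fm.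
have sub : `[p, q]%classic `<=` Rpos.
  by move=> x /=; rewrite !in_itv/= andbT => /andP[+ _]; apply: lt_le_trans.
have intpq : mu.-integrable `[p, q]%classic (EFin \o f).
  by apply: integrableS intf.
apply: (@le_trans _ _ (\int[mu]_(x in `[p, q]%classic) f x)).
  have -> : m * (q - p) = \int[mu]_(x in `[p, q]%classic) m.
    rewrite Rintegral_cst//; congr (_ * _).
    rewrite [X in fine X]lebesgue_measure_itv/= lte_fin.
    by move: pq; rewrite le_eqVlt => /predU1P[->|->]//; rewrite subrr ltxx.
  apply: le_Rintegral => //.
    apply: measurable_bounded_integrable => //.
      by rewrite [X in (X < _)%E]lebesgue_measure_itv/=; case: ifP; rewrite ltry.
    by exists `|m|; split=> // y my x _ /=; rewrite ltW.
rewrite fine_le//.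
- exact: integrable_fin_num.
- exact: integrable_fin_num.
- apply: ge0_subset_integral => //.
    by case/integrableP: intf.
  by move=> x /=; rewrite in_itv/= andbT => x0; rewrite lee_fin f0.
Qed.

Lemma jump_integralB alpha g h x : 1 < alpha < 2 -> Ckb 2 g -> Ckb 2 h ->
  jump_integral alpha (fun y => g y - h y) x =
  jump_integral alpha g x - jump_integral alpha h x.
Proof.
move=> a12 Cg Ch; rewrite /jump_integral -RintegralB//; last 2 first.
- exact: integrable_jump.
- exact: integrable_jump.
apply: eq_Rintegral => xi _; rewrite /jump /increment.
have [_ -> _] := Ckb2_sub Cg Ch; rewrite -mulrBl; congr (_ * _); ring.
Qed.

(** The left integral is the right one for the reflected function, so that every
statement about jump integrals need only be proved for one of them. *)
Lemma RieszFellerE alpha theta g x : alpha != 2 -> Ckb 2 g ->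
  RieszFeller alpha theta g x =
  Defs.coef1 alpha theta * jump_integral alpha g x +
  Defs.coef2 alpha theta * jump_integral alpha (fun y => g (- y)) (- x).
Proof.
move=> /negbTE a2 Cg; rewrite /RieszFeller a2; congr (_ * _ + _ * _).
apply: eq_Rintegral => xi _; rewrite /jump /increment.
have [_ -> _] := Ckb2_opp_arg Cg.
by rewrite opprD !opprK mulNr opprK.
Qed.

Lemma RieszFeller2 theta g x : RieszFeller 2 theta g x = g^`(2) x.
Proof. by rewrite /RieszFeller eqxx. Qed.

Lemma coef1N alpha theta : Defs.coef1 alpha (- theta) = Defs.coef2 alpha theta.
Proof. by []. Qed.

Lemma coef2N alpha theta : Defs.coef2 alpha (- theta) = Defs.coef1 alpha theta.
Proof. by rewrite /Defs.coef2 opprK. Qed.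

Lemma RieszFeller_reflect alpha theta g x : Ckb 2 g ->
  RieszFeller alpha (- theta) (fun y => g (- y)) x =
  RieszFeller alpha theta g (- x).
Proof.
move=> Cg; have [CNg _ g2] := Ckb2_opp_arg Cg.
have [a2|a2] := eqVneq alpha 2; first by rewrite /RieszFeller a2 eqxx g2.
rewrite (RieszFellerE (- theta) x a2 CNg) (RieszFellerE theta (- x) a2 Cg).
rewrite coef1N coef2N.
have -> : (fun y => g (- - y)) = g by apply/funext => y; rewrite (opprK y).
rewrite (opprK x).
by rewrite [LHS]addrC.
Qed.

Lemma RieszFellerB alpha theta g h x : 1 < alpha <= 2 -> Ckb 2 g -> Ckb 2 h ->
  RieszFeller alpha theta (fun y => g y - h y) x =
  RieszFeller alpha theta g x - RieszFeller alpha theta h x.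
Proof.
move=> /andP[a1 a2] Cg Ch.
have [a2'|a2'] := eqVneq alpha 2.
  by have [_ _ e] := Ckb2_sub Cg Ch; rewrite /RieszFeller a2' eqxx e.
have a12 : 1 < alpha < 2 by rewrite a1 lt_neqAle a2'.
have [Cgh _ _] := Ckb2_sub Cg Ch.
have [CNg _ _] := Ckb2_opp_arg Cg; have [CNh _ _] := Ckb2_opp_arg Ch.
rewrite (RieszFellerE theta x a2' Cgh) (RieszFellerE theta x a2' Cg).
rewrite (RieszFellerE theta x a2' Ch).
rewrite [X in _ + _ * X = _](jump_integralB (- x) a12 CNg CNh).
rewrite [X in _ * X + _ = _](jump_integralB x a12 Cg Ch).
have dist (k1 k2 A B C D : R) :
  k1 * (A - B) + k2 * (C - D) = k1 * A + k2 * C - (k1 * B + k2 * D) by ring.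
exact: dist.
Qed.

Lemma RieszFeller_cst alpha theta (a x : R) : RieszFeller alpha theta (cst a) x = 0.
Proof.
have [_ e1 e2] := Ckb2_cst a; rewrite /RieszFeller e1 e2.
case: ifP => // _.
under eq_Rintegral do rewrite /= !mul0r subrr subr0 mul0r.
under [X in _ + _ * X]eq_Rintegral do rewrite /= !mul0r subrr addr0 mul0r.
by rewrite Rintegral_cst// mul0r !mulr0 addr0.
Qed.

(** The integrand is dominated by 16 exp(- t / 2), because
t^(s - 1) <= 1 + t^2 <= 16 (1 + t/4)^2 <= 16 exp(t / 2); on [1, 2] it is at least
exp(- 2). *)
Lemma Gamma_gt0 (s : R) : 1 <= s <= 3 -> 0 < Gamma s.
Proof.
move=> /andP[s1 s3]; rewrite /Gamma.
have dexp (x : R) : is_derive x 1 (fun t : R => - expR (- (t / 2)))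
   (expR (- (x / 2)) / 2).
  have d1 : is_derive x 1 (fun t : R => - (t / 2)) (- (1 / 2)).
    by apply: is_derive_eq; rewrite /GRing.scale/=; field.
  have := is_deriveN (@is_derive1_comp _ expR (fun t : R => - (t / 2)) x _ _
    (is_derive_expR _) d1).
  by congr is_derive; field.
have intE : mu.-integrable Rpos (EFin \o (fun t : R => expR (- (t / 2)) / 2)).
  apply: (@integrable_bounded_primitive _ _ (fun t : R => - expR (- (t / 2))) 1).
  - by move=> x _; rewrite divr_ge0// expR_ge0.
  - move=> x _; apply: cvgM; last exact: cvg_cst.
    apply: (@continuous_comp _ _ _ (fun t : R => - (t / 2)) expR).
      by apply: cvgN; apply: cvgM; [exact: cvg_id|exact: cvg_cst].
    exact: continuous_expR.
  - move=> x x0; rewrite normrN ger0_norm ?expR_ge0// -expR0 ler_expR oppr_le0.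
    by rewrite divr_ge0// ltW.
have intG : mu.-integrable Rpos (EFin \o (fun t : R => t `^ (s - 1) * expR (- t))).
  apply: (@le_integrable _ _ _ mu _ _ _
    (fun t => 32%:E * (expR (- (t / 2)) / 2)%:E)%E) => //.
  - apply/measurable_EFinP; apply: open_continuous_measurable_fun => //.
    move=> y; rewrite inE/= in_itv/= andbT => y0.
    apply: cvgM; first exact: powR_continuous.
    apply: (@continuous_comp _ _ _ (fun t : R => - t) expR).
      by apply: cvgN; exact: cvg_id.
    exact: continuous_expR.
  - move=> t; rewrite /= in_itv/= andbT => t0.
    rewrite lee_fin !ger0_norm ?mulr_ge0 ?expR_ge0 ?powR_ge0//.
    have -> : - t = - (t / 2) + - (t / 2) by field.
    rewrite expRD.
    have -> : 32 * (expR (- (t / 2)) / 2) = 16 * expR (- (t / 2)) by field.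
    rewrite mulrA ler_wpM2r ?expR_ge0// expRN ler_pdivrMr ?expR_gt0//.
    have h1 : t `^ (s - 1) <= 1 + t ^+ 2.
      have [t1|/ltW t1] := leP t 1.
        apply: (@le_trans _ _ 1); last by rewrite lerDl sqr_ge0.
        rewrite -[leRHS](_ : 1 `^ (s - 1) = 1); last by rewrite powR1.
        by rewrite ge0_ler_powR ?nnegrE ?subr_ge0 ?(ltW t0).
      apply: (@le_trans _ _ (t ^+ 2)); last by rewrite lerDr.
      rewrite -powR_mulrn ?(ltW t0)// ler_powR//; lra.
    have h2 : 1 + t / 4 <= expR (t / 4) by exact: expR_ge1Dx.
    have -> : t / 2 = t / 4 + t / 4 by field.
    rewrite expRD (le_trans h1)//.
    have h3 : (1 + t / 4) * (1 + t / 4) <= expR (t / 4) * expR (t / 4).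
      by rewrite ler_pM// addr_ge0// divr_ge0// ltW.
    rewrite (le_trans _ (ler_wpM2l _ h3))//; nra.
  - exact: integrableZl.
apply: (@lt_le_trans _ _ (expR (- 2) * (2 - 1))).
  by rewrite mulr_gt0 ?expR_gt0// subr_gt0 ltr1n.
apply: (@Rintegral_ge_itv (fun t => t `^ (s - 1) * expR (- t))) => //.
- by rewrite ler1n.
- by move=> x _; rewrite mulr_ge0 ?powR_ge0 ?expR_ge0.
- move=> x /andP[x1 x2]; rewrite -[leLHS]mul1r ler_pM ?expR_ge0//.
    rewrite -[leLHS](_ : 1 `^ (s - 1) = 1); last by rewrite powR1.
    by rewrite ge0_ler_powR ?nnegrE ?subr_ge0// (le_trans _ x1).
  by rewrite ler_expR lerN2.
Qed.

(** The angles (alpha + theta) pi / 2 and (alpha - theta) pi / 2 lie in (0, pi], and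
they cannot both be equal to pi as their sum is alpha pi < 2 pi. *)
Lemma coef_sign alpha theta : 1 < alpha < 2 ->
  `|theta| <= Num.min alpha (2 - alpha) ->
  [/\ 0 <= Defs.coef1 alpha theta, 0 <= Defs.coef2 alpha theta &
      0 < Defs.coef1 alpha theta \/ 0 < Defs.coef2 alpha theta].
Proof.
move=> /andP[a1 a2]; rewrite le_min => /andP[_]; rewrite ler_norml => /andP[t1 t2].
have G0 : 0 < Gamma (1 + alpha) by apply: Gamma_gt0; lra.
have p0 : 0 < pi / 2 :> R by rewrite divr_gt0 ?pi_gt0.
have sge0 (z : R) : 0 <= z <= 2 -> 0 <= Gamma (1 + alpha) * sin (z * pi / 2) / pi.
  move=> /andP[z0 z2]; rewrite divr_ge0 ?pi_ge0// mulr_ge0 ?(ltW G0)//.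
  apply: sin_ge0_pi; rewrite -mulrA mulr_ge0 ?(ltW p0)//=.
  by rewrite [leRHS](_ : pi = 2 * (pi / 2)); [rewrite ler_wpM2r// ltW|field].
have sgt0 (z : R) : 0 < z < 2 -> 0 < Gamma (1 + alpha) * sin (z * pi / 2) / pi.
  move=> /andP[z0 z2]; rewrite divr_gt0 ?pi_gt0// mulr_gt0//.
  apply: sin_gt0_pi; rewrite -mulrA mulr_gt0//=.
  by rewrite [ltRHS](_ : pi = 2 * (pi / 2)); [rewrite ltr_pM2r|field].
split; [apply: sge0; lra|apply: sge0; lra|].
have [t3|t3] := ltP theta (2 - alpha); [left|right]; apply: sgt0; lra.
Qed.

End riesz_feller.

(** * Operator at a minimum *)

Section minimum.
Context {R : realType}.
Implicit Types (g W : R -> R) (alpha theta : R).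

(** If g2 c < 0 then g2 < 0 to the right of c by continuity, and two applications
of the mean value theorem make g smaller than g c just to the right of c. *)
Lemma local_min_derive2 g (g1 g2 : R -> R) (a b c : R) :
  (forall x : R, is_derive x 1 g (g1 x)) ->
  (forall x : R, is_derive x 1 g1 (g2 x)) -> continuous g2 ->
  a < c < b -> (forall x, a < x < b -> g c <= g x) ->
  g1 c = 0 /\ 0 <= g2 c.
Proof.
move=> dg dg1 cg2 /andP[ac cb] gmin.
have g1c : g1 c = 0.
  have dgc0 : is_derive c 1 g 0.
    apply: (@derive1_at_min _ g a b) => //.
    - by rewrite ltW// (lt_trans ac).
    - by rewrite in_itv/= ac cb.
  by have := @derive_val _ _ _ _ _ _ _ dgc0; rewrite (@derive_val _ _ _ _ _ _ _ (dg c)).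
split=> //; rewrite leNgt; apply/negP => g2c.
have /nbhs_ballP[e /= e0 ge] : \forall x \near c, g2 x < 0.
  exact: (cvgr_lt _ (cg2 c)).
pose d := Num.min (e / 2) ((b - c) / 2).
have d0 : 0 < d by rewrite lt_min !divr_gt0// subr_gt0.
have de : d < e by rewrite gt_min ltr_pdivrMr// ltr_pMr// ltr1n.
have db : c + d < b.
  have : d <= (b - c) / 2 by rewrite ge_min lexx orbT.
  lra.
have cd : c < c + d by rewrite ltrDl.
have [y + ey] := @MVT _ g g1 c (c + d) cd
  (fun z _ => dg z) (continuous_subspaceT (is_derive_continuousT dg)).
rewrite in_itv/= => /andP[cy yd].
have [z + ez] := @MVT _ g1 g2 c y cy
  (fun z _ => dg1 z) (continuous_subspaceT (is_derive_continuousT dg1)).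
rewrite in_itv/= => /andP[cz zy].
have : g2 z < 0.
  apply: ge; rewrite /ball/= distrC gtr0_norm ?subr_gt0//.
  by rewrite ltrBlDl (lt_trans zy)// (lt_trans yd)// ltrD2l.
move: ez; rewrite g1c subr0 => ez g2z.
have : g1 y < 0 by rewrite ez pmulr_llt0// subr_gt0.
have := gmin (c + d); rewrite db (lt_trans ac cd) => /(_ isT).
rewrite -subr_ge0 ey addrAC subrr add0r => + g1y.
by rewrite leNgt pmulr_llt0// g1y.
Qed.

Lemma min_derive2 W x0 : Ckb 2 W -> (forall x, W x0 <= W x) ->
  W^`() x0 = 0 /\ 0 <= W^`(2)%classic x0.
Proof.
move=> /Ckb2_elim[dW dW1 cW2 _] Wmin.
apply: (@local_min_derive2 W _ _ (x0 - 1) (x0 + 1) x0 dW dW1 cW2) => [|x _//].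
by rewrite gtrBl ltrDl ltr01.
Qed.

Lemma min_jump_ge0 alpha W x0 xi : Ckb 2 W -> (forall x, W x0 <= W x) ->
  0 <= jump alpha W x0 xi.
Proof.
move=> CW Wmin; have [W1 _] := min_derive2 CW Wmin.
by rewrite /jump /increment W1 mul0r subr0 divr_ge0 ?powR_ge0// subr_ge0.
Qed.

Lemma min_jump_integral_ge0 alpha W x0 : Ckb 2 W -> (forall x, W x0 <= W x) ->
  0 <= jump_integral alpha W x0.
Proof. by move=> CW Wmin; apply: Rintegral_ge0 => xi _; exact: min_jump_ge0. Qed.

Section admissible.
Variables alpha theta : R.
Hypothesis alpha12 : 1 < alpha <= 2.
Hypothesis thetaP : `|theta| <= Num.min alpha (2 - alpha).

Lemma alpha_lt2 : alpha != 2 -> 1 < alpha < 2.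
Proof. by move: alpha12 => /andP[-> a2] /= a2'; rewrite lt_neqAle a2'. Qed.

Lemma RieszFeller_min_ge0 W x0 : Ckb 2 W -> (forall x, W x0 <= W x) ->
  0 <= RieszFeller alpha theta W x0.
Proof.
move=> CW Wmin; have [a2|a2] := eqVneq alpha 2.
  by rewrite a2 RieszFeller2; have [] := min_derive2 CW Wmin.
have [c1 c2 _] := coef_sign (alpha_lt2 a2) thetaP.
have [CNW _ _] := Ckb2_opp_arg CW.
rewrite RieszFellerE// addr_ge0// mulr_ge0// min_jump_integral_ge0// => x.
by rewrite opprK.
Qed.

(** The integrand of the right jump integral is then nonnegative with zero
integral; a point to the right where W is larger would give a segment on which
the integrand is bounded below by a positive constant. *)
Lemma RieszFeller_min_right W x0 : alpha != 2 -> 0 < Defs.coef1 alpha theta ->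
  Ckb 2 W -> (forall x, W x0 <= W x) -> RieszFeller alpha theta W x0 <= 0 ->
  forall x, x0 <= x -> W x = W x0.
Proof.
move=> a2 c1 CW Wmin DW x; rewrite le_eqVlt => /predU1P[->//|x0x].
have a12 := alpha_lt2 a2.
have [CNW _ _] := Ckb2_opp_arg CW.
have [_ c2 _] := coef_sign a12 thetaP.
have J0 : jump_integral alpha W x0 <= 0.
  rewrite -(pmulr_rle0 _ c1); apply: le_trans DW.
  rewrite RieszFellerE// lerDl mulr_ge0// min_jump_integral_ge0// => y.
  by rewrite opprK.
apply/eqP; rewrite eq_le Wmin andbT leNgt; apply/negP => Wx.
have [W1 _] := min_derive2 CW Wmin.
have [dW _ _ _] := Ckb2_elim CW.
pose m := (W x + W x0) / 2.
have /nbhs_ballP[e /= e0 We] : \forall y \near x, m < W y.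
  have cW : W y @[y --> x] --> W x by exact: is_derive_continuous (dW x).
  by apply: (cvgr_gt _ cW); rewrite /m; lra.
have p0 : 0 < x - x0 by rewrite subr_gt0.
have pq : x - x0 <= x - x0 + e / 2 by rewrite lerDl divr_ge0// ltW.
pose M := (x - x0 + e / 2) `^ (1 + alpha).
have M0 : 0 < M by rewrite powR_gt0// (lt_le_trans p0).
have := @Rintegral_ge_itv _ (jump alpha W x0) _ _ ((m - W x0) / M) p0 pq
  (integrable_jump x0 a12 CW) (fun xi _ => min_jump_ge0 alpha xi CW Wmin).
suff h : forall xi, x - x0 <= xi <= x - x0 + e / 2 ->
    (m - W x0) / M <= jump alpha W x0 xi.
  move=> /(_ h) /le_trans /(_ J0); rewrite leNgt => /negP; apply.
  rewrite addrAC subrr add0r mulr_gt0 ?divr_gt0// subr_gt0 /m; lra.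
move=> xi /andP[pxi xiq]; have xi0 : 0 < xi by exact: lt_le_trans pxi.
rewrite /jump /increment W1 mul0r subr0 ler_pM//.
- rewrite subr_ge0 /m; lra.
- by rewrite invr_ge0 ltW.
- rewrite lerD2r ltW//; apply: We; rewrite /ball/= distrC ger0_norm; lra.
- rewrite lef_pV2 ?posrE ?powR_gt0//; last by rewrite (lt_le_trans p0).
  rewrite ge0_ler_powR ?nnegrE ?(ltW xi0)//; last by rewrite (le_trans _ pq)// ltW.
  by case/andP: a12 => a1 _; lra.
Qed.

End admissible.

Lemma RieszFeller_min_left alpha theta W x0 : 1 < alpha <= 2 ->
  `|theta| <= Num.min alpha (2 - alpha) ->
  alpha != 2 -> 0 < Defs.coef2 alpha theta ->
  Ckb 2 W -> (forall x, W x0 <= W x) -> RieszFeller alpha theta W x0 <= 0 ->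
  forall x, x <= x0 -> W x = W x0.
Proof.
move=> a12 thP a2 c2 CW Wmin DW x xx0; have [CNW _ _] := Ckb2_opp_arg CW.
have thP' : `|- theta| <= Num.min alpha (2 - alpha) by rewrite normrN.
have Wmin' y : W (- - x0) <= W (- y) by rewrite opprK.
have DW' : RieszFeller alpha (- theta) (fun y => W (- y)) (- x0) <= 0.
  by rewrite (RieszFeller_reflect alpha theta (- x0) CW) (opprK x0).
have xx0' : - x0 <= - x by rewrite lerN2.
have := RieszFeller_min_right a12 thP' a2 c2 CNW Wmin' DW' xx0'.
by rewrite (opprK x) (opprK x0).
Qed.

(** The hypotheses say that x0 - s is a minimum over (x0 - r, +oo) of the function
W minus the parabola eps (x0 - x)^2 cut off to the right of x0.  The jump
integrand of W is thus bounded below by that of the convex function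
eps (max (x0 - x) 0)^2, which is nonnegative, and at least
eps s^2 / (2 s)^(1 + alpha) on [s, 2 s].  When alpha = 2 the bound is the
inequality between second derivatives. *)
Lemma RieszFeller_barrier alpha theta W (x0 r s eps : R) : 1 < alpha <= 2 ->
  `|theta| <= Num.min alpha (2 - alpha) ->
  alpha = 2 \/ Defs.coef2 alpha theta = 0 ->
  Ckb 2 W -> 0 < s < r -> 0 <= eps ->
  (forall x, x0 - r < x <= x0 ->
     eps * ((x0 - x) ^+ 2 - s ^+ 2) <= W x - W (x0 - s)) ->
  (forall x, x0 <= x -> - (eps * s ^+ 2) <= W x - W (x0 - s)) ->
  W^`() (x0 - s) = - (2 * eps * s) /\
  (if alpha == 2 then 2 else Defs.coef1 alpha theta / 2 `^ (1 + alpha))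
     * (eps * s `^ (2 - alpha)) <= RieszFeller alpha theta W (x0 - s).
Proof.
move=> a12 thP ac CW /andP[s0 sr] eps0 Wl Wr.
have [dW dW1 cW2 _] := Ckb2_elim CW.
set x1 := x0 - s.
pose q1 (x : R) := 2 * eps * (x - x0).
have dq (x : R) : is_derive x 1 (fun x => eps * (x0 - x) ^+ 2) (q1 x).
  have d1 : is_derive x 1 (fun x : R => x0 - x) (- 1).
    by apply: is_derive_eq; rewrite ?/GRing.scale/=; ring.
  by apply: is_derive_eq; rewrite /GRing.scale/= /q1; ring.
have dq1 (x : R) : is_derive x 1 q1 (2 * eps).
  by apply: is_derive_eq; rewrite /GRing.scale/=; ring.
have [||/eqP W1 W2] := @local_min_derive2 (fun x => W x - eps * (x0 - x) ^+ 2)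
    (fun x => W^`()%classic x - q1 x) (fun x => W^`(2)%classic x - 2 * eps)
    (x0 - r) x0 x1 _ _ (fun x => cvgB (cW2 x) (@cvg_cst _ _ _ _ _)).
- by rewrite /x1 ltrD2l ltrN2 sr gtrBl.
- move=> x /andP[rx xx0]; have := Wl x; rewrite rx (ltW xx0) => /(_ isT).
  by have -> : x0 - x1 = s by [rewrite /x1; ring]; rewrite -/x1 mulrBr; lra.
move: W1; rewrite subr_eq0 => /eqP W1.
have {}W1 : W^`()%classic x1 = - (2 * eps * s).
  by rewrite W1 /q1 /x1; ring.
split => //.
have [a2|a2] := eqVneq alpha 2.
  by rewrite a2 RieszFeller2 subrr powRr0; lra.
case: ac => [/eqP|c20]; first by rewrite (negbTE a2).
have a12' := alpha_lt2 a12 a2; have [c1 _ _] := coef_sign a12' thP.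
rewrite RieszFellerE// c20 mul0r addr0 -mulrA ler_wpM2l//.
have jump_ge xi : 0 < xi -> (0 <= jump alpha W x1 xi) /\
   (s <= xi -> (eps * (2 * s * xi - s ^+ 2)) / xi `^ (1 + alpha) <= jump alpha W x1 xi).
  move=> xi0; rewrite /jump /increment W1.
  have [sxi|xis] := ltP s xi.
    have := Wr (x1 + xi); rewrite -/x1 => /(_ _).
    have -> : x0 <= x1 + xi by [rewrite /x1; lra].
    move=> /(_ isT) h.
    have h1 : eps * (2 * s * xi - s ^+ 2) <= W (x1 + xi) - W x1 - - (2 * eps * s) * xi.
      by rewrite mulrBr; lra.
    split.
      rewrite divr_ge0 ?powR_ge0// (le_trans _ h1)// mulr_ge0//; nra.
    by move=> _; rewrite ler_wpM2r// invr_ge0 powR_ge0.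
  have := Wl (x1 + xi); rewrite -/x1 => /(_ _).
  have -> : x0 - r < x1 + xi <= x0 by [rewrite /x1; lra].
  move=> /(_ isT).
  have -> : x0 - (x1 + xi) = s - xi by [rewrite /x1; ring].
  move=> h.
  have h1 : eps * xi ^+ 2 <= W (x1 + xi) - W x1 - - (2 * eps * s) * xi.
    by move: h; rewrite [leLHS](_ : _ = eps * xi ^+ 2 - 2 * eps * s * xi); [lra|ring].
  split.
    by rewrite divr_ge0 ?powR_ge0// (le_trans _ h1)// mulr_ge0// sqr_ge0.
  move=> sxi; rewrite ler_wpM2r ?invr_ge0 ?powR_ge0//.
  have -> : s = xi by apply/eqP; rewrite eq_le sxi.
  move: h1; have -> : s = xi by apply/eqP; rewrite eq_le sxi.
  lra.
have s2s : s <= 2 * s by lra.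
have := @Rintegral_ge_itv _ (jump alpha W x1) _ _
  (eps * s ^+ 2 / (2 * s) `^ (1 + alpha)) s0 s2s
  (integrable_jump x1 a12' CW) (fun xi xi0 => (jump_ge xi xi0).1).
(* The lower bound of the integrand on [s, 2 s], times the length s. *)
have e : (2 `^ (1 + alpha))^-1 * (eps * s `^ (2 - alpha)) =
    eps * s ^+ 2 / (2 * s) `^ (1 + alpha) * (2 * s - s).
  rewrite powRM ?(ltW s0)//.
  have -> : 2 - alpha = 3%:R - (1 + alpha) by ring.
  rewrite powRB; last by rewrite (gt_eqF s0) implybT.
  rewrite powR_mulrn ?(ltW s0)//; field.
  by rewrite !gt_eqF ?powR_gt0.
rewrite e; apply => xi /andP[sxi xis].
have xi0 : 0 < xi by exact: lt_le_trans sxi.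
apply: le_trans ((jump_ge xi xi0).2 sxi).
apply: ler_pM.
- by rewrite mulr_ge0// sqr_ge0.
- by rewrite invr_ge0 powR_ge0.
- by rewrite ler_wpM2l//; nra.
rewrite lef_pV2 ?posrE ?powR_gt0 ?mulr_gt0//.
rewrite ge0_ler_powR ?nnegrE ?(ltW xi0) ?mulr_ge0 ?(ltW s0)//.
by case/andP: a12; lra.
Qed.

End minimum.

(** * Strong maximum principle *)

Section strong_maximum.
Context {R : realType}.
Implicit Types (W : R -> R) (alpha theta : R).

Lemma powR_le_small (p k : R) : 0 < p -> 0 < k ->
  exists2 r, 0 < r <= 1 & r `^ p <= k.
Proof.
move=> p0 k0; exists (Num.min 1 (k `^ p^-1)).
  by rewrite lt_min ltr01 powR_gt0// ge_min lexx.
have {2}-> : k = (k `^ p^-1) `^ p.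
  by rewrite -powRrM mulVf ?gt_eqF// powRr1// ltW.
rewrite ge0_ler_powR ?(ltW p0) ?nnegrE ?powR_ge0//.
- by rewrite le_min ler01 powR_ge0.
- by rewrite ge_min lexx orbT.
Qed.

(** Near a point where it vanishes to second order, W lies below every parabola. *)
Lemma flat_zero_lt_sqr W x0 eps r : Ckb 2 W -> W x0 = 0 -> W^`() x0 = 0 ->
  W^`(2) x0 = 0 -> 0 < eps -> 0 < r ->
  exists2 s, 0 < s < r & W (x0 - s) < eps * s ^+ 2.
Proof.
move=> CW Wx0 W1 W2 eps0 r0.
have [_ _ cW2 _] := Ckb2_elim CW.
have : \forall x \near x0, `|W^`(2)%classic x| < eps / 2.
  have : `|W^`(2)%classic x| @[x --> x0] --> `|W^`(2)%classic x0|.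
    by apply: cvg_norm; exact: cW2.
  by move=> /cvgr_lt; apply; rewrite W2 normr0 divr_gt0.
move=> /nbhs_ballP[e /= e0 We].
pose s := Num.min (r / 2) (e / 2).
have s0 : 0 < s by rewrite lt_min !divr_gt0.
have sr : s < r by rewrite gt_min ltr_pdivrMr// ltr_pMr// ltr1n.
have se : s < e by rewrite gt_min orbC ltr_pdivrMr// ltr_pMr// ltr1n.
exists s; first by rewrite s0.
have lt_half : eps / 2 * s ^+ 2 < eps * s ^+ 2.
  by rewrite ltr_pM2r ?exprn_gt0// ltr_pdivrMr// ltr_pMr// ltr1n.
have [CNW NW1 NW2] := Ckb2_opp_arg CW.
have := @taylor2_bound _ (fun x => W (- x)) (- x0) s (eps / 2) CNW (ltW s0).
rewrite NW1 NW2 opprD !opprK W1 Wx0 oppr0 mul0r subr0 addr0 => h.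
apply: le_lt_trans lt_half; apply: le_trans (ler_norm _) (h _) => y /andP[y1 y2].
by apply/ltW/We; rewrite /ball/= opprK ger0_norm; lra.
Qed.

(** If W (x0 - r) > 0, choose eps so small that the parabola eps (x0 - x)^2 is below
W at x0 - r.  As W is flat at x0, the difference is negative somewhere in
between, so it has an interior minimum, at distance s < r from x0, where
W < eps s^2.  The barrier estimate then gives
kappa eps s^(2 - alpha) <= C (2 eps s + eps s^2) <= 3 C eps s, which is false if
s^(alpha - 1) is small compared with kappa / C.  The radius r0 depends on the
constants only, so that the argument can be iterated. *)
Lemma zero_left_uniform alpha theta (C : R) : 1 < alpha <= 2 ->
  `|theta| <= Num.min alpha (2 - alpha) ->
  alpha = 2 \/ (0 < Defs.coef1 alpha theta /\ Defs.coef2 alpha theta = 0) ->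
  0 <= C ->
  exists2 r0, 0 < r0 & forall W x0, Ckb 2 W -> (forall x, 0 <= W x) ->
    W x0 = 0 -> W^`(2) x0 = 0 ->
    (forall x, RieszFeller alpha theta W x <= C * (`|W^`()%classic x| + W x)) ->
    forall r, 0 < r <= r0 -> W (x0 - r) = 0.
Proof.
move=> a12 thP ac C0.
pose kappa : R := if alpha == 2 then 2 else Defs.coef1 alpha theta / 2 `^ (1 + alpha).
have kappa0 : 0 < kappa.
  rewrite /kappa; case: ifPn => // a2; case: ac => [/eqP|[c1 _]].
    by rewrite (negbTE a2).
  by rewrite divr_gt0// powR_gt0.
have a1 : 0 < alpha - 1 by case/andP: a12; rewrite subr_gt0.
have C1 : 0 < 3 * C + 1 by rewrite ltr_wpDl// mulr_ge0.
have [r0 /andP[r00 r01] r0k] := powR_le_small a1 (divr_gt0 kappa0 C1).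
exists r0 => // W x0 CW W0 Wx0 W2 DW r /andP[rp rr0].
apply/eqP; rewrite eq_le W0 andbT leNgt; apply/negP => Wr.
have Wmin x : W x0 <= W x by rewrite Wx0.
have [W1 _] := min_derive2 CW Wmin.
have [dW _ _ _] := Ckb2_elim CW.
(* Half of the value for which the parabola meets W at x0 - r. *)
pose eps := W (x0 - r) / (2 * r ^+ 2).
have eps0 : 0 < eps by rewrite divr_gt0// mulr_gt0// exprn_gt0.
pose h x := W x - eps * (x0 - x) ^+ 2.
have ch : continuous h.
  move=> x; apply: cvgB.
    exact: is_derive_continuous (dW x).
  apply: cvgM; first exact: cvg_cst.
  have cs : x0 - y @[y --> x] --> x0 - x by apply: cvgB; [exact: cvg_cst|exact: cvg_id].
  exact: (cvgM cs cs).
have x0r : x0 - r <= x0 by rewrite gerBl ltW.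
have [x1 + x1min] := EVT_min x0r (continuous_subspaceT ch).
rewrite in_itv/= => /andP[rx1 x1x0].
have [s' /andP[s'0 s'r] Ws'] := flat_zero_lt_sqr CW Wx0 W1 W2 eps0 rp.
have hx1 : h x1 < 0.
  apply: (@le_lt_trans _ _ (h (x0 - s'))).
    by apply: x1min; rewrite in_itv/=; apply/andP; split; lra.
  rewrite /h; have -> : x0 - (x0 - s') = s' by ring.
  by rewrite subr_lt0.
have x1r : x1 != x0 - r.
  apply/eqP => e; move: hx1; rewrite e /h; have -> : x0 - (x0 - r) = r by ring.
  have -> : eps * r ^+ 2 = W (x0 - r) / 2 by rewrite /eps; field; rewrite gt_eqF.
  lra.
have x1n : x1 != x0.
  by apply/eqP => e; move: hx1; rewrite e /h Wx0 subrr expr0n mulr0 subrr ltxx.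
pose s := x0 - x1.
have s0 : 0 < s by rewrite subr_gt0 lt_neqAle x1n.
have sr : s < r.
  have : x0 - r < x1 by rewrite lt_neqAle eq_sym x1r.
  by rewrite /s; lra.
have ex1 : x0 - s = x1 by rewrite /s; ring.
have ac' : alpha = 2 \/ Defs.coef2 alpha theta = 0.
  by case: ac => [->|[_ ->]]; [left|right].
have ss : 0 < s < r by rewrite s0.
have := @RieszFeller_barrier _ alpha theta W x0 r s eps a12 thP ac' CW ss (ltW eps0).
rewrite -/kappa ex1 => /(_ _ _)[].
- move=> x /andP[x2 x3]; have := x1min x.
  rewrite in_itv/= (ltW x2) x3 => /(_ isT); rewrite /h -/s; lra.
- by move=> x _; have := W0 x; move: hx1; rewrite /h -/s; lra.
move=> W1x1 kD.
have Wx1 : W x1 <= eps * s ^+ 2 by move: hx1; rewrite /h -/s; lra.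
have s1 : s <= 1 by rewrite (le_trans (ltW sr))// (le_trans rr0).
have up : kappa * (eps * s `^ (2 - alpha)) <= C * (eps * (3 * s)).
  apply: le_trans kD _; apply: le_trans (DW x1) _; rewrite ler_wpM2l//.
  rewrite W1x1 normrN ger0_norm; last first.
    by rewrite mulr_ge0 ?(ltW s0)// mulr_ge0 ?(ltW eps0).
  apply: (@le_trans _ _ (2 * eps * s + eps * s ^+ 2)); first by rewrite lerD2l.
  have : eps * s ^+ 2 <= eps * s by rewrite ler_wpM2l ?(ltW eps0)// expr2 ler_piMr ?(ltW s0).
  lra.
have sE : s = s `^ (2 - alpha) * s `^ (alpha - 1).
  rewrite -powRD; last by rewrite (gt_eqF s0) implybT.
  by rewrite (_ : 2 - alpha + (alpha - 1) = 1) ?powRr1 ?(ltW s0)//; ring.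
have P0 : 0 < eps * s `^ (2 - alpha) by rewrite mulr_gt0// powR_gt0.
have : kappa <= 3 * C * s `^ (alpha - 1).
  rewrite -(ler_pM2r P0) (le_trans up)//.
  by rewrite le_eqVlt {1}sE; apply/orP; left; apply/eqP; ring.
rewrite leNgt => /negP; apply.
apply: (@le_lt_trans _ _ (3 * C * (kappa / (3 * C + 1)))).
  rewrite ler_wpM2l ?mulr_ge0// (le_trans _ r0k)//.
  by rewrite ge0_ler_powR ?nnegrE ?(ltW a1) ?(ltW s0) ?(ltW r00)// (le_trans (ltW sr)).
rewrite mulrA ltr_pdivrMr// mulrC ltr_pM2l//; lra.
Qed.

(** If the second coefficient is positive the operator sees the left side and the
zero propagates at once.  Otherwise the zeros are flat, as the second derivative
vanishes there: for alpha = 2 by the differential inequality, for alpha < 2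
because W vanishes on the right.  Then the zero moves left by steps of a fixed
length. *)
Lemma zero_left alpha theta (C : R) W x0 : 1 < alpha <= 2 ->
  `|theta| <= Num.min alpha (2 - alpha) -> 0 <= C ->
  Ckb 2 W -> (forall x, 0 <= W x) -> W x0 = 0 ->
  (forall x, RieszFeller alpha theta W x <= C * (`|W^`()%classic x| + W x)) ->
  forall x, x <= x0 -> W x = 0.
Proof.
move=> a12 thP C0 CW W0 Wx0 DW.
have Wmin z : W z = 0 -> forall x, W z <= W x by move=> ->.
have D0 z : W z = 0 -> RieszFeller alpha theta W z <= 0.
  move=> Wz; apply: le_trans (DW z) _; have [-> _] := min_derive2 CW (Wmin z Wz).
  by rewrite Wz normr0 addr0 mulr0.
have [/andP[a2 c2]|nc] := boolP ((alpha != 2) && (0 < Defs.coef2 alpha theta)).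
  move=> x xx0; rewrite -[RHS]Wx0.
  exact: (RieszFeller_min_left a12 thP a2 c2 CW (Wmin x0 Wx0) (D0 x0 Wx0) xx0).
have ac : alpha = 2 \/ (0 < Defs.coef1 alpha theta /\ Defs.coef2 alpha theta = 0).
  have [a2|a2] := eqVneq alpha 2; [by left|right].
  have [_ c2 c12] := coef_sign (alpha_lt2 a12 a2) thP.
  move: nc; rewrite a2/= -leNgt => c2'.
  have c20 : Defs.coef2 alpha theta = 0 by apply/eqP; rewrite eq_le c2'.
  by split => //; case: c12 => //; rewrite c20 ltxx.
have W2 z : W z = 0 -> W^`(2) z = 0.
  move=> Wz; have [_ W2z] := min_derive2 CW (Wmin z Wz).
  have [a2|a2] := eqVneq alpha 2.
    by apply/eqP; rewrite eq_le W2z andbT; have := D0 z Wz; rewrite a2 RieszFeller2.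
  case: ac => [/eqP|[c1 _]]; first by rewrite (negbTE a2).
  have Wr x : z <= x -> W x = 0.
    move=> zx; rewrite -[RHS]Wz.
    exact: (RieszFeller_min_right a12 thP a2 c1 CW (Wmin z Wz) (D0 z Wz) zx).
  have [_ _ cW2 _] := Ckb2_elim CW.
  have W2r x : z < x -> W^`(2) x = 0.
    have dzero (k : R -> R) y : z < y -> (forall t, z < t -> k t = 0) -> k^`() y = 0.
      move=> zy k0; rewrite derive1E.
      have -> : 'D_1 k y = 'D_1 (cst (0 : R)) y.
        apply: near_eq_derive.
        by near=> t; rewrite k0//; near: t; exact: lt_nbhsr.
      exact: derive_cst.
    move=> zx; rewrite derive1nS derive1n1; apply: (dzero _ _ zx) => t zt.
    by apply: (dzero W t zt) => u zu; rewrite Wr// ltW.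
  have h : W^`(2)%classic x @[x --> z^'+] --> W^`(2)%classic z.
    exact: cvg_at_right_filter (cW2 z).
  have h0 : W^`(2)%classic x @[x --> z^'+] --> (0 : R).
    apply: cvg_near_cst; near=> x; apply: W2r; near: x; exact: nbhs_right_gt.
  exact: (cvg_unique _ h h0).
have [r0 r00 step] := zero_left_uniform a12 thP ac C0.
have main n x : x0 - r0 * n%:R <= x <= x0 -> W x = 0.
  elim: n x => [|n IH] x /andP[x1 x2].
    by have -> : x = x0 by apply/eqP; rewrite eq_le x2; move: x1; rewrite mulr0 subr0.
  have [xn|xn] := leP (x0 - r0 * n%:R) x; first by apply: IH; rewrite xn.
  have Wn : W (x0 - r0 * n%:R) = 0.
    by apply: IH; rewrite lexx gerBl mulr_ge0// ltW.
  have := step W (x0 - r0 * n%:R) CW W0 Wn (W2 _ Wn) DW (x0 - r0 * n%:R - x).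
  have -> : x0 - r0 * n%:R - (x0 - r0 * n%:R - x) = x by ring.
  apply; rewrite subr_gt0 xn/=.
  by move: x1; rewrite -natr1 mulrDr mulr1; lra.
move=> x xx0; apply: (main (Num.truncn ((x0 - x) / r0)).+1).
rewrite xx0 andbT lerBlDr -lerBlDl -ler_pdivrMl// mulrC.
exact/ltW/truncnS_gt.
Unshelve. all: by end_near. Qed.

Lemma strong_max alpha theta (C : R) W x0 : 1 < alpha <= 2 ->
  `|theta| <= Num.min alpha (2 - alpha) -> 0 <= C ->
  Ckb 2 W -> (forall x, 0 <= W x) -> W x0 = 0 ->
  (forall x, RieszFeller alpha theta W x <= C * (`|W^`()%classic x| + W x)) ->
  forall x, W x = 0.
Proof.
move=> a12 thP C0 CW W0 Wx0 DW x; have [xx0|/ltW x0x] := leP x x0.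
  exact: (zero_left a12 thP C0 CW W0 Wx0 DW).
have [CNW NW1 _] := Ckb2_opp_arg CW.
have thP' : `|- theta| <= Num.min alpha (2 - alpha) by rewrite normrN.
have Wx0' : W (- - x0) = 0 by rewrite (opprK x0).
have DW' y : RieszFeller alpha (- theta) (fun z => W (- z)) y <=
    C * (`|(fun z => W (- z))^`()%classic y| + W (- y)).
  by rewrite (RieszFeller_reflect alpha theta y CW) NW1 normrN; exact: (DW (- y)).
have xx0' : - x <= - x0 by rewrite lerN2.
rewrite -(opprK x).
exact: (zero_left a12 thP' C0 CNW (fun y => W0 (- y)) Wx0' DW' xx0').
Qed.

End strong_maximum.

(** * Sliding one profile along the other *)

Section slide.
Context {R : realType}.
Implicit Types (g h : R -> R).

Lemma near_ninfty_le (P : R -> Prop) : (\forall x \near -oo, P x) ->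
  exists2 K, 0 < K & forall x, x <= - K -> P x.
Proof.
move=> [M [_ MP]]; exists (`|M| + 1); first by rewrite ltr_wpDl.
move=> x xK; apply: MP; have := ler_norm (- M); rewrite normrN; lra.
Qed.

Lemma near_pinfty_ge (P : R -> Prop) : (\forall x \near +oo, P x) ->
  exists2 K, 0 < K & forall x, K <= x -> P x.
Proof.
move=> [M [_ MP]]; exists (`|M| + 1); first by rewrite ltr_wpDl.
move=> x xK; apply: MP; have := ler_norm M; lra.
Qed.

Lemma continuous_attains_min h (K y : R) : continuous h ->
  (forall x, x <= - K \/ K <= x -> h y <= h x) ->
  exists x0, forall x, h x0 <= h x.
Proof.
move=> ch hK; pose K' := Num.max K `|y|.
have yK : - K' <= y <= K' by rewrite -ler_norml le_max lexx orbT.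
have KK : - K' <= K' by case/andP: yK; exact: le_trans.
have [x0 _ x0min] := EVT_min KK (continuous_subspaceT ch).
have x0y : h x0 <= h y by apply: x0min; rewrite in_itv.
exists x0 => x; have [xK|/ltW xK] := leP x (- K').
  apply: (le_trans x0y); apply: hK; left; rewrite (le_trans xK)// lerN2.
  by rewrite le_max lexx.
have [Kx|/ltW Kx] := leP K' x.
  by apply: (le_trans x0y); apply: hK; right; rewrite (le_trans _ Kx)// le_max lexx.
by apply: x0min; rewrite in_itv/= xK Kx.
Qed.

Lemma Ckb2_continuous g : Ckb 2 g -> continuous g.
Proof. by move=> [[_ cg] _]; exact: (cg 0%N). Qed.

Lemma derive1_gt0_lt g : Ckb 2 g -> (forall x, 0 < g^`()%classic x) ->
  {homo g : x y / x < y}.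
Proof.
move=> Cg g1 x y xy; have [dg _ _ _] := Ckb2_elim Cg.
have [z _ e] := @MVT _ g g^`()%classic x y xy (fun z _ => dg z)
  (continuous_subspaceT (Ckb2_continuous Cg)).
by rewrite -subr_gt0 e mulr_gt0// subr_gt0.
Qed.

Lemma Ckb2_lipschitz g : Ckb 2 g ->
  exists2 M, 0 < M & forall x y, x <= y -> g y - g x <= M * (y - x).
Proof.
move=> Cg; have [dg _ _ [M gM]] := Ckb2_elim Cg.
have M0 : 0 <= M by have [+ _ _] := gM 0; apply: le_trans.
exists (M + 1) => [|x y xy]; first by rewrite ltr_wpDl.
have [z _ ->] := @MVT_segment _ g g^`()%classic x y xy (fun z _ => dg z)
  (continuous_subspaceT (Ckb2_continuous Cg)).
rewrite ler_wpM2r ?subr_ge0//.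
by have [_ + _] := gM z; have := ler_norm (g^`()%classic z); lra.
Qed.

Section sliding.
Variables (alpha theta : R) (f U V : R -> R) (c c' L eta : R).
Hypotheses (alpha12 : 1 < alpha <= 2)
  (thetaP : `|theta| <= Num.min alpha (2 - alpha)).
Hypotheses (L0 : 0 <= L) (eta0 : 0 < eta).
Hypothesis fL : forall u v : R, 0 <= u <= 1 -> 0 <= v <= 1 ->
  `|f u - f v| <= L * `|u - v|.
Hypothesis f_well0 : forall u v : R, 0 <= u -> u < v -> v <= eta -> f v < f u.
Hypothesis f_well1 : forall u v : R, 1 - eta <= u -> u < v -> v <= 1 -> f v < f u.
Hypotheses (waveU : traveling_wave alpha theta f U c)
  (waveV : traveling_wave alpha theta f V c').
Hypothesis dU : forall x : R, 0 < U^`()%classic x.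
Hypotheses (Um : U x @[x --> -oo] --> (0 : R))
  (Up : U x @[x --> +oo] --> (1 : R))
  (Vm : V x @[x --> -oo] --> (0 : R))
  (Vp : V x @[x --> +oo] --> (1 : R)).
Hypothesis V01 : forall x : R, 0 <= V x <= 1.
Hypothesis c'c : c' <= c.

Let CU : Ckb 2 U. Proof. by case/traveling_waveP: waveU. Qed.
Let CV : Ckb 2 V. Proof. by case/traveling_waveP: waveV. Qed.
Let Uinc : {homo U : x y / x < y}. Proof. exact: derive1_gt0_lt. Qed.
Let Uhomo : {homo U : x y / x <= y}.
Proof. by move=> x y; rewrite le_eqVlt => /predU1P[->//|/Uinc/ltW]. Qed.

Let U01 x : 0 <= U x <= 1.
Proof.
apply/andP; split; rewrite leNgt; apply/negP => Ux.
- have [K K0 UK] := near_ninfty_le (cvgr_gt _ Um _ Ux).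
  have := UK (Num.min x (- K)); rewrite ge_min lexx orbT => /(_ isT).
  by rewrite ltNge Uhomo// ge_min lexx.
- have [K K0 UK] := near_pinfty_ge (cvgr_lt _ Up _ Ux).
  have := UK (Num.max x K); rewrite le_max lexx orbT => /(_ isT).
  by rewrite ltNge Uhomo// le_max lexx.
Qed.

Let diff tau x := U (x + tau) - V x.

Let Cdiff tau : [/\ Ckb 2 (diff tau),
  (diff tau)^`()%classic = (fun x => U^`()%classic (x + tau) - V^`()%classic x) &
  forall x, RieszFeller alpha theta (diff tau) x =
    - c * U^`()%classic (x + tau) - f (U (x + tau))
    - (- c' * V^`()%classic x - f (V x))].
Proof.
have CUt := Ckb_shift tau CU; have [CD D1 _] := Ckb2_sub CUt CV.
split; first exact: CD.
  by rewrite D1; apply/funext => x; rewrite derive1_shift.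
move=> x; rewrite (RieszFellerB theta x alpha12 CUt CV) RieszFeller_shift.
have [_ eU] := (traveling_waveP alpha theta f U c).1 waveU.
have [_ eV] := (traveling_waveP alpha theta f V c').1 waveV.
by rewrite eU eV !addrK.
Qed.

(** The difference of the two profile equations at a point where the first
derivatives agree and the operator is nonnegative. *)
Let touching tau x0 : (forall x, diff tau x0 <= diff tau x) ->
  f (U (x0 + tau)) <= f (V x0) + (c' - c) * U^`()%classic (x0 + tau).
Proof.
move=> dmin; have [CD D1 DE] := Cdiff tau.
have := RieszFeller_min_ge0 alpha12 thetaP CD dmin.
have [+ _] := min_derive2 CD dmin.
rewrite D1 => /eqP; rewrite subr_eq0 => /eqP D1x.
by rewrite DE -D1x; lra.
Qed.

(** Otherwise U(. + tau) - V has a negative global minimum, at which f (U) <= f (V)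
by the previous inequality, although U < V lie in one of the two intervals where
f decreases strictly. *)
Let ordered tau :
  (forall x, U (x + tau) < V x -> V x <= eta \/ 1 - eta <= U (x + tau)) ->
  forall x, V x <= U (x + tau).
Proof.
move=> wells y; rewrite leNgt; apply/negP => Vy.
have dy : diff tau y < 0 by rewrite subr_lt0.
have [CD _ _] := Cdiff tau.
have dy' : 0 < - diff tau y by rewrite oppr_gt0.
have [K1 K10 VK] := near_ninfty_le (cvgr_lt _ Vm _ dy').
have dy1 : 1 + diff tau y < 1 by rewrite gtrDl.
have [K2 K20 UK] := near_pinfty_ge (cvgr_gt _ Up _ dy1).
have [x0 x0min] : exists x0, forall x, diff tau x0 <= diff tau x.
  apply: (@continuous_attains_min _ (Num.max K1 (K2 + `|tau|)) y).
    exact: Ckb2_continuous.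
  move=> x [xK|Kx].
    have : x <= - K1 by rewrite (le_trans xK)// lerN2 le_max lexx.
    move=> /VK Vx; have /andP[Ux _] := U01 (x + tau).
    by rewrite [leRHS]/diff; lra.
  have : K2 <= x + tau.
    have : K2 + `|tau| <= x by rewrite (le_trans _ Kx)// le_max lexx orbT.
    by have := ler_norm (- tau); rewrite normrN; lra.
  move=> /UK Ux; have /andP[_ Vx] := V01 x.
  by rewrite [leRHS]/diff; lra.
have UVx0 : U (x0 + tau) < V x0.
  by rewrite -subr_lt0; exact: le_lt_trans (x0min y) dy.
have := touching x0min; rewrite leNgt => /negP; apply.
apply: (@le_lt_trans _ _ (f (V x0))).
  by rewrite gerDl mulr_le0_ge0 ?subr_le0// ltW.
have /andP[Ux0 _] := U01 (x0 + tau); have /andP[_ Vx0] := V01 x0.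
by case: (wells x0 UVx0) => h; [exact: f_well0|exact: f_well1].
Qed.

(** Far to the left V is close to 0; elsewhere U(. + tau) is close to 1. *)
Let ordered_large : exists tau, forall x, V x <= U (x + tau).
Proof.
have [K1 K10 VK] := near_ninfty_le (cvgr_lt _ Vm _ eta0).
have eta1 : 1 - eta < 1 by rewrite gtrBl.
have [K2 K20 UK] := near_pinfty_ge (cvgr_gt _ Up _ eta1).
exists (K1 + K2); apply: ordered => x _.
have [/VK/ltW|xK] := leP x (- K1); first by left.
by right; apply/ltW/UK; lra.
Qed.

(** The two curves touch at the least shift t with V <= U(. + t).  At the touching
point c' = c follows from U' > 0, and then the strong maximum principle applies
to the difference. *)
Lemma sliding_method : c' = c /\ exists tau, forall x, V x = U (x + tau).
Proof.
pose S : set R := [set tau | forall x, V x <= U (x + tau)].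
have S0 : S !=set0 by have [tau] := ordered_large; exists tau.
have [y Vy] : exists y, 0 < V y.
  have [K _ VK] := near_pinfty_ge (cvgr_gt _ Vp _ (@ltr01 R)).
  by exists K; exact: VK.
have lbS : has_lbound S.
  have [K _ UK] := near_ninfty_le (cvgr_lt _ Um _ Vy).
  exists (- K - y) => tau Stau; rewrite leNgt; apply/negP => tauK.
  have yK : y + tau <= - K by lra.
  by have := lt_le_trans (UK _ yK) (Stau y); rewrite ltxx.
have infS : has_inf S by [].
pose t := inf S.
(* S is closed, by continuity of U. *)
have St : S t.
  move=> x; rewrite leNgt; apply/negP => UV.
  have cUx : U z @[z --> x + t] --> U (x + t) by exact: Ckb2_continuous.
  have /nbhs_ballP[e /= e0 Ue] : \forall z \near x + t, U z < V x.
    exact: (cvgr_lt _ cUx).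
  have [tau Stau taue] := inf_adherent e0 infS.
  have ttau : t <= tau by exact: ge_inf.
  have := Stau x; rewrite leNgt => /negP; apply; apply: Ue.
  rewrite /ball/= distrC ger0_norm; first by rewrite -/t in taue; lra.
  by lra.
have [CD D1 DE] := Cdiff t.
have dge0 x : 0 <= diff t x by rewrite subr_ge0; exact: St.
(* Without a contact point a slightly smaller shift would still be in S. *)
have [x0 dx0] : exists x0, diff t x0 = 0.
  apply: contrapT => nd.
  have dgt0 x : 0 < diff t x.
    by rewrite lt_neqAle dge0 andbT eq_sym; apply/eqP => e; apply: nd; exists x.
  have [K1 K10 VK] := near_ninfty_le (cvgr_lt _ Vm _ eta0).
  have eta1 : 1 - eta < 1 by rewrite gtrBl.
  have [K2 K20 UK] := near_pinfty_ge (cvgr_gt _ Up _ eta1).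
  (* Beyond b every shift between t - 1 and t leaves U above 1 - eta. *)
  pose b := K2 + `|t| + 1.
  have b0 : - K1 <= b by have := normr_ge0 t; rewrite /b; lra.
  have [m _ dm] := EVT_min b0 (continuous_subspaceT (Ckb2_continuous CD)).
  have [M M0 UM] := Ckb2_lipschitz CU.
  pose e := Num.min 1 (diff t m / M).
  have e0 : 0 < e by rewrite lt_min ltr01 divr_gt0.
  have e1 : e <= 1 by rewrite ge_min lexx.
  have eM : M * e <= diff t m by rewrite mulrC -ler_pdivlMr// ge_min lexx orbT.
  have Ste : S (t - e).
    apply: ordered => x Ux.
    have [/VK/ltW|xK] := leP x (- K1); first by left.
    have [xb|bx] := leP x b.
      have dx : diff t m <= diff t x by apply: dm; rewrite in_itv/= (ltW xK) xb.
      have ee : x + (t - e) <= x + t by lra.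
      have := UM _ _ ee; rewrite (_ : x + t - (x + (t - e)) = e); last by ring.
      by move: dx eM; rewrite {2}/diff; lra.
    right; apply/ltW/UK; have := ler_norm (- t); rewrite normrN.
    by move: bx; rewrite /b; lra.
  have := ge_inf lbS Ste; rewrite -/t; lra.
have dmin x : diff t x0 <= diff t x by rewrite dx0.
have UVx0 : U (x0 + t) = V x0 by apply/eqP; rewrite -subr_eq0; exact/eqP.
have cc' : c' = c.
  apply/eqP; rewrite eq_le c'c -subr_ge0 -(pmulr_lge0 _ (dU (x0 + t))).
  by have := touching dmin; rewrite UVx0; lra.
split=> //; exists t => x; apply/esym/eqP; rewrite -subr_eq0; apply/eqP.
have CL : 0 <= `|c| + L by rewrite addr_ge0.
apply: (@strong_max _ alpha theta (`|c| + L) (diff t) x0) => // z.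
rewrite DE D1 cc'.
have h1 := fL (U01 (z + t)) (V01 z).
rewrite -/(diff t z) (ger0_norm (dge0 z)) in h1.
set a := U^`()%classic (z + t) - V^`()%classic z.
have -> : - c * U^`()%classic (z + t) - f (U (z + t)) -
    (- c * V^`()%classic z - f (V z)) =
    - (c * a) - (f (U (z + t)) - f (V z)) by rewrite /a; ring.
apply: le_trans (ler_norm _) _; apply: le_trans (ler_normB _ _) _.
rewrite normrN normrM mulrDr !mulrDl.
have := mulr_ge0 (normr_ge0 c) (dge0 z); have := mulr_ge0 L0 (normr_ge0 a).
lra.
Qed.

End sliding.

End slide.

(** * Reflection and uniqueness *)

Section uniqueness.
Context {R : realType}.
Implicit Types (f U V : R -> R) (alpha theta : R).

(** This symmetry exchanges the rest states 0 and 1 and the two ends of the line, so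
it maps profiles that increase from 0 to 1 to such profiles, while it reverses
the order of two speeds. *)
Lemma traveling_wave_reflect alpha theta f U (c : R) : 1 < alpha <= 2 ->
  traveling_wave alpha theta f U c ->
  traveling_wave alpha (- theta) (fun u => - f (1 - u))
    (fun x => 1 - U (- x)) (- c).
Proof.
move=> a12 /traveling_waveP[CU eU]; apply/traveling_waveP.
have [C1 D1 _] := Ckb2_cst (1 : R).
have [CN DN _] := Ckb2_opp_arg CU.
have [CB DB _] := Ckb2_sub C1 CN.
split; first exact: CB.
move=> x; rewrite DB D1 DN (RieszFellerB (- theta) x a12 C1 CN).
rewrite RieszFeller_cst (RieszFeller_reflect alpha theta x CU) /=.
rewrite (_ : 1 - (1 - U (- x)) = U (- x)); last by ring.
have := eU (- x).
move: (RieszFeller alpha theta U (- x)) (U^`()%classic (- x)) (f (U (- x))).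
move=> D u1 fu e; transitivity (- (- c * u1)); first by ring.
by rewrite e; ring.
Qed.

Lemma derivable_lipschitz f (a b : R) :
  (forall x : R, derivable f x 1) -> continuous f^`() ->
  exists2 L, 0 <= L & forall u v, a <= u <= b -> a <= v <= b ->
    `|f u - f v| <= L * `|u - v|.
Proof.
move=> df cf1; have [ab|ba] := leP a b; last first.
  exists 0 => // u v /andP[au ub].
  by have := lt_le_trans ba (le_trans au ub); rewrite ltxx.
have cf : continuous f.
  by move=> x; apply: differentiable_continuous; exact/derivable1_diffP.
have cn : continuous (fun x => `|f^`()%classic x|).
  by move=> x; apply: cvg_norm; exact: cf1.
have [m _ fm] := EVT_max ab (continuous_subspaceT cn).
exists `|f^`()%classic m| => //.
have main u v : a <= u -> v <= b -> u <= v ->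
    `|f v - f u| <= `|f^`()%classic m| * `|v - u|.
  move=> au vb uv.
  have dfx (x : R) : x \in `]u, v[%R -> is_derive x 1 f (f^`()%classic x).
    by move=> _; rewrite derive1E; exact: derivableP.
  have [z + ->] := MVT_segment uv dfx (continuous_subspaceT cf).
  rewrite in_itv/= => /andP[uz zv]; rewrite normrM ler_wpM2r//.
  by apply: fm; rewrite in_itv/= (le_trans au uz) (le_trans zv vb).
move=> u v /andP[au ub] /andP[av vb]; have [uv|/ltW vu] := leP u v.
  by rewrite distrC (distrC u); exact: main.
exact: main.
Qed.

Lemma derive1_lt0_decr f (a : R) :
  (forall x : R, derivable f x 1) -> continuous f^`() -> f^`()%classic a < 0 ->
  exists2 eta, 0 < eta & forall u v, a - eta <= u -> u < v -> v <= a + eta ->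
    f v < f u.
Proof.
move=> df cf1 fa.
have cf : continuous f.
  by move=> x; apply: differentiable_continuous; exact/derivable1_diffP.
have /nbhs_ballP[e /= e0 fe] : \forall x \near a, f^`()%classic x < 0.
  exact: (cvgr_lt _ (cf1 a)).
exists (e / 2) => [|u v au uv va]; first by rewrite divr_gt0.
have dfx (x : R) : x \in `]u, v[%R -> is_derive x 1 f (f^`()%classic x).
  by move=> _; rewrite derive1E; exact: derivableP.
have [z + ez] := MVT uv dfx (continuous_subspaceT cf).
rewrite in_itv/= => /andP[uz zv].
rewrite -subr_lt0 ez pmulr_llt0 ?subr_gt0//; apply: fe.
by rewrite /ball/= distrC ltr_norml; apply/andP; split; lra.
Qed.

(** Continuity of the derivative of f gives the Lipschitz constant on [0, 1] and the
strict decrease near 0 and near 1 on which the sliding argument relies. *)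
Lemma uniqueness_of_slower_wave alpha theta f U V (c c' : R) : 1 < alpha <= 2 ->
  `|theta| <= Num.min alpha (2 - alpha) ->
  (forall x : R, derivable f x 1) -> continuous f^`() ->
  f^`()%classic 0 < 0 -> f^`()%classic 1 < 0 ->
  traveling_wave alpha theta f U c -> traveling_wave alpha theta f V c' ->
  (forall x : R, 0 < U^`()%classic x) ->
  U x @[x --> -oo] --> (0 : R) -> U x @[x --> +oo] --> (1 : R) ->
  V x @[x --> -oo] --> (0 : R) -> V x @[x --> +oo] --> (1 : R) ->
  (forall x : R, 0 <= V x <= 1) -> c' <= c ->
  c' = c /\ exists tau, forall x, V x = U (x + tau).
Proof.
move=> a12 thP df cf1 f0 f1 wU wV dU Um Up Vm Vp V01 cc.
have [L L0 fL] := derivable_lipschitz 0 1 df cf1.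
have [e0 e00 fe0] := derive1_lt0_decr df cf1 f0.
have [e1 e10 fe1] := derive1_lt0_decr df cf1 f1.
pose eta := Num.min e0 e1.
have eta0 : 0 < eta by rewrite lt_min e00 e10.
have le0 : eta <= e0 by rewrite ge_min lexx.
have le1 : eta <= e1 by rewrite ge_min lexx orbT.
have w0 u v : 0 <= u -> u < v -> v <= eta -> f v < f u.
  by move=> u0 uv ve; apply: fe0 => //; lra.
have w1 u v : 1 - eta <= u -> u < v -> v <= 1 -> f v < f u.
  by move=> u0 uv ve; apply: fe1 => //; lra.
exact: (sliding_method a12 thP L0 eta0 fL w0 w1 wU wV dU Um Up Vm Vp V01 cc).
Qed.

End uniqueness.

Unset Implicit Arguments.
Set Strict Implicit.

(** The order of the speeds decides whether the sliding argument is applied to the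
profiles themselves or to their reflections. *)
Theorem theoremA2 (R : realType) (alpha theta : R) (f : R -> R)
  (halpha : 1 < alpha <= 2)
  (htheta : `|theta| <= Num.min alpha (2 - alpha))
  (hf : smooth f) (hf0 : f 0 = 0) (hf1 : f 1 = 0)
  (hdf0 : f^`() 0 < 0) (hdf1 : f^`() 1 < 0)
  (U : R -> R) (c : R)
  (hU : traveling_wave alpha theta f U c)
  (hU1 : Ck 1 U)
  (hUm : U x @[x --> -oo] --> (0 : R)) (hUp : U x @[x --> +oo] --> (1 : R))
  (hdU : forall x : R, 0 < U^`() x)
  (hdUm : U^`() x @[x --> -oo] --> (0 : R)) (hdUp : U^`() x @[x --> +oo] --> (0 : R)) :
  forall (V : R -> R) (c' : R),
    traveling_wave alpha theta f V c' ->
    continuous V ->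
    V x @[x --> -oo] --> (0 : R) -> V x @[x --> +oo] --> (1 : R) ->
    (forall x : R, 0 <= V x <= 1) ->
    c' = c /\ exists x0 : R, forall x : R, V x = U (x + x0).
Proof.
move=> V c' wV _ Vm Vp V01.
have df (x : R) : derivable f x 1 by exact: (hf 0%N).
have cf1 : continuous f^`().
  by move=> x; apply: differentiable_continuous; exact/derivable1_diffP/(hf 1%N).
have [cc|/ltW cc] := leP c' c.
  exact: (uniqueness_of_slower_wave halpha htheta df cf1 hdf0 hdf1 hU wV hdU
    hUm hUp Vm Vp V01 cc).
pose g u := - f (1 - u).
have dg (x : R) : is_derive x 1 g (f^`()%classic (1 - x)).
  have d1 : is_derive x 1 (fun u : R => 1 - u) (- 1).
    by apply: is_derive_eq; rewrite ?/GRing.scale/=; ring.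
  have d2 : is_derive (1 - x) 1 f (f^`()%classic (1 - x)).
    by rewrite derive1E; exact: derivableP.
  have := is_deriveN (@is_derive1_comp _ f (fun u : R => 1 - u) x _ _ d2 d1).
  by rewrite mulrN1 opprK.
have g1E : g^`() = (fun x => f^`()%classic (1 - x)).
  by apply/funext => x; rewrite derive1E; exact: derive_val.
have dg' (x : R) : derivable g x 1 by exact: (@ex_derive _ _ _ _ _ _ _ (dg x)).
have cg1 : continuous g^`().
  rewrite g1E => x; apply: (@continuous_comp _ _ _ (fun y : R => 1 - y) f^`()%classic).
    by apply: cvgB; [exact: cvg_cst|exact: cvg_id].
  exact: cf1.
have htheta' : `|- theta| <= Num.min alpha (2 - alpha) by rewrite normrN.
have wU' := traveling_wave_reflect halpha hU.
have wV' := traveling_wave_reflect halpha wV.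
have CU : Ckb 2 U by case/traveling_waveP: hU.
have dU' (x : R) : 0 < (fun y => 1 - U (- y))^`()%classic x.
  have [C1 D1 _] := Ckb2_cst (1 : R).
  have [CN DN _] := Ckb2_opp_arg CU.
  have [_ -> _] := Ckb2_sub C1 CN.
  by rewrite D1 DN sub0r opprK.
have limN (W : R -> R) (l : R) : W x @[x --> +oo] --> l ->
    1 - W (- x) @[x --> -oo] --> 1 - l.
  by move=> Wl; apply: cvgB; [exact: cvg_cst|exact/cvgy_compNP].
have limP (W : R -> R) (l : R) : W x @[x --> -oo] --> l ->
    1 - W (- x) @[x --> +oo] --> 1 - l.
  by move=> Wl; apply: cvgB; [exact: cvg_cst|exact/cvgNy_compNP].
have Um' := limN _ _ hUp; have Up' := limP _ _ hUm.
have Vm' := limN _ _ Vp; have Vp' := limP _ _ Vm.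
rewrite subrr in Um' Vm'; rewrite subr0 in Up' Vp'.
have V01' (x : R) : 0 <= 1 - V (- x) <= 1.
  by have := V01 (- x); lra.
have cc' : - c' <= - c by rewrite lerN2.
have g0 : g^`()%classic 0 < 0 by rewrite g1E subr0.
have g1 : g^`()%classic 1 < 0 by rewrite g1E subrr.
have [ec [tau VU]] := uniqueness_of_slower_wave halpha htheta' dg' cg1 g0 g1
  wU' wV' dU' Um' Up' Vm' Vp' V01' cc'.
split; first exact: oppr_inj.
exists (- tau) => x; have := VU (- x).
by rewrite opprK opprD opprK => /(addrI 1)/oppr_inj.
Qed.
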